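(* Let $n\geqslant 1$ be an integer, let $c,H>0$ and let $b,m^2\geqslant 0$ be such that $b^2\geqslant 4m^2$. Let $\beta\geqslant 0$, $p>1$ and set $$r_{\mathrm{crit}}(b,m^2,\beta,p)=\tfrac12\left(b-\sqrt{b^2-4m^2}\right)\left((\beta+1)p-1\right),\qquad \kappa_{\mathrm{crit}}(b,m^2,\beta,p)=\begin{cases}-1 & \text{if } b^2>4m^2,\\ -1-(\beta+1)p & \text{if } b^2=4m^2.\end{cases}$$ Consider $\Gamma(t)=\mu\,\mathrm{e}^{r_{\mathrm{crit}}(b,m^2,\beta,p)t}(1+t)^{\kappa_{\mathrm{crit}}(b,m^2,\beta,p)}$ for some $\mu>0$ in the nonlinear term $$f(t,u)=\Gamma(t)\left(\int_{\mathbb{R}^n}|u(t,y)|^p\,\mathrm{d}y\right)^{\beta}|u|^p .$$ Let $u_0,u_1\in L^1_{\mathrm{loc}}(\mathbb{R}^n)$ be nonnegative, nontrivial and compactly supported functions with supports contained in $B_R$ for some $R>0$. Let $u\in\mathcal{C}^1([0,T),L^1_{\mathrm{loc}}(\mathbb{R}^n))$ be a weak solution (in the sense defined in the context) to the Cauchy problem $$\begin{cases}\partial_t^2u-c^2\mathrm{e}^{-2Ht}\Delta u+b\,\partial_tu+m^2u=f(t,u), & x\in\mathbb{R}^n,\ t\in(0,T),\\ u(0,x)=\varepsilon u_0(x), & x\in\mathbb{R}^n,\\ \partial_tu(0,x)=\varepsilon u_1(x), & x\in\mathbb{R}^n,\end{cases}$$ with lifespan $T=T(\varepsilon)$. Then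 there exists a positive constant $\varepsilon_0=\varepsilon_0(n,c,H,b,m^2,\beta,p,\mu,u_0,u_1,R)$ such that for any $\varepsilon\in(0,\varepsilon_0]$ the weak solution $u$ blows up in finite time. Furthermore, the following upper bound estimate for the lifespan holds: $$T(\varepsilon)\leqslant C\exp\left(K\varepsilon^{-\left((\beta+1)p-1\right)}\right),$$ where the positive constants $C,K$ are independent of $\varepsilon$.
   Context: Here $\varepsilon>0$ is a parameter describing the size of the initial data, $B_\rho=\{x\in\mathbb{R}^n:|x|\leqslant\rho\}$, and $T=T(\varepsilon)\in(0,\infty]$ denotes the lifespan, i.e. the maximal existence time, of the weak solution; blow-up in finite time means $T(\varepsilon)<\infty$. Set $A_{\mathrm{dS}}(t)=\int_0^t c\,\mathrm{e}^{-H\tau}\,\mathrm{d}\tau=\frac{c}{H}(1-\mathrm{e}^{-Ht})$. Definition (weak solution). Let $u_0,u_1\in L^1_{\mathrm{loc}}(\mathbb{R}^n)$ with $\operatorname{supp}u_0,\operatorname{supp}u_1\subset B_R$ for some $R>0$. A function $u\in\mathcal{C}^1([0,T),L^1_{\mathrm{loc}}(\mathbb{R}^n))$ such that $f(t,u)\in L^1_{\mathrm{loc}}((0,T)\times\mathbb{R}^n)$ is a weak solution to the Cauchy problem on $[0,T)$ if $\operatorname{supp}u(t,\cdot)\subset B_{R+A_{\mathrm{dS}}(t)}$ for any $t\in(0,T)$ and the integral identity $$\begin{aligned}&\int_{\mathbb{R}^n}\partial_tu(t,x)\varphi(t,x)\,\mathrm{d}x-\int_{\mathbb{R}^n}u(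t,x)\varphi_t(t,x)\,\mathrm{d}x+b\int_{\mathbb{R}^n}u(t,x)\varphi(t,x)\,\mathrm{d}x\\&\quad+\int_0^t\int_{\mathbb{R}^n}u(s,x)\left(\varphi_{ss}(s,x)-c^2\mathrm{e}^{-2Hs}\Delta\varphi(s,x)-b\,\varphi_s(s,x)+m^2\varphi(s,x)\right)\mathrm{d}x\,\mathrm{d}s\\&=\varepsilon\int_{\mathbb{R}^n}u_1(x)\varphi(0,x)\,\mathrm{d}x+\varepsilon\int_{\mathbb{R}^n}u_0(x)\left(b\,\varphi(0,x)-\varphi_t(0,x)\right)\mathrm{d}x\\&\quad+\int_0^t\Gamma(s)\left(\int_{\mathbb{R}^n}|u(s,y)|^p\,\mathrm{d}y\right)^{\beta}\int_{\mathbb{R}^n}|u(s,x)|^p\varphi(s,x)\,\mathrm{d}x\,\mathrm{d}s\end{aligned}$$ holds for any $t\in(0,T)$ and any test function $\varphi\in\mathcal{C}^\infty_0([0,T)\times\mathbb{R}^n)$. *)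

(* Defs.v *)
From HB Require Import structures.
From mathcomp Require Import all_boot all_order all_algebra.
From mathcomp Require Import all_classical all_reals all_analysis.
From mathcomp Require Import measurable_realfun.

Set Implicit Arguments.
Unset Strict Implicit.
Unset Printing Implicit Defensive.

Import Order.TTheory GRing.Theory Num.Theory.
Import numFieldNormedType.Exports.

Local Open Scope classical_set_scope.
Local Open Scope ring_scope.

(* The sigma-algebra on 'rV[R]_n generated by the coordinate maps, i.e. the
   Borel sigma-algebra of R^n (same construction as for n.-tuple R). *)
Section measurable_rV.
Variables (R : realType) (n : nat).

Let coors : 'I_n -> 'rV[R]_n -> R := fun i x => x ord0 i.

Let rV_set0 : g_sigma_preimage coors set0.
Proof. exact: sigma_algebra0. Qed.

Let rV_setC A : g_sigma_preimage coors A -> g_sigma_preimage coors (~` A).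
Proof. exact: sigma_algebraC. Qed.

Let rV_bigcup (F : (set 'rV[R]_n)^nat) :
  (forall i, g_sigma_preimage coors (F i)) ->
  g_sigma_preimage coors (\bigcup_i (F i)).
Proof. exact: sigma_algebra_bigcup. Qed.

HB.instance Definition _ := @isMeasurable.Build default_measure_display
  'rV[R]_n (g_sigma_preimage coors) rV_set0 rV_setC rV_bigcup.

Lemma measurable_coord (i : 'I_n) :
  measurable_fun [set: 'rV[R]_n] (fun x : 'rV[R]_n => x ord0 i).
Proof.
move=> _ Y mY; rewrite setTI; apply: sub_sigma_algebra => /=.
rewrite -bigcup_seq/=; exists i => /=; first by rewrite mem_index_enum.
by exists Y => //; rewrite setTI.
Qed.

Lemma measurable_fun_coord d (X : measurableType d) (f : X -> 'rV[R]_n) :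
  (forall i, measurable_fun [set: X] (fun z => f z ord0 i)) ->
  measurable_fun [set: X] f.
Proof.
move=> mf _ Y mY; rewrite setTI.
pose F := image_set_system [set: X] f measurable.
suff : F Y by rewrite /F /image_set_system /= setTI.
move: Y mY; apply: smallest_sub.
  exact: sigma_algebra_image (sigma_algebra_measurable _).
rewrite -bigcup_seq/= => A [i _] [B mB <-].
rewrite /F /image_set_system /= !setTI -[X in measurable X]setTI.
exact: mf.
Qed.

End measurable_rV.

(* n-dimensional Lebesgue measure, by induction on n through the bijection
   R * R^n -> R^(n+1). *)
Section lebesgue_rV.
Context {R : realType}.

Definition row_cons n (p : R * 'rV[R]_n) : 'rV[R]_n.+1 :=
  \row_(i < n.+1) (if unlift ord0 i is Some j then p.2 ord0 j else p.1).

Definition row_uncons n (x : 'rV[R]_n.+1) : R * 'rV[R]_n :=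
  (x ord0 ord0, \row_(i < n) x ord0 (lift ord0 i)).

Lemma row_cons0 n (p : R * 'rV[R]_n) : row_cons p ord0 ord0 = p.1.
Proof. by rewrite mxE unlift_none. Qed.

Lemma row_consS n (p : R * 'rV[R]_n) (i : 'I_n) :
  row_cons p ord0 (lift ord0 i) = p.2 ord0 i.
Proof. by rewrite mxE liftK. Qed.

Lemma row_consK n : cancel (@row_cons n) (@row_uncons n).
Proof.
move=> [a x]; rewrite /row_uncons row_cons0; congr pair.
by apply/rowP => i; rewrite mxE row_consS.
Qed.

Lemma row_unconsK n : cancel (@row_uncons n) (@row_cons n).
Proof.
move=> x; apply/rowP => i; case: (unliftP ord0 i) => [j ->|->].
  by rewrite row_consS mxE.
by rewrite row_cons0.
Qed.

Lemma measurable_row_cons n : measurable_fun [set: R * 'rV[R]_n] (@row_cons n).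
Proof.
apply: measurable_fun_coord => i; case: (unliftP ord0 i) => [j ->|->].
  under eq_fun do rewrite row_consS.
  exact: (measurableT_comp (measurable_coord j) measurable_snd).
under eq_fun do rewrite row_cons0.
exact: measurable_fst.
Qed.

Lemma measurable_row_uncons n :
  measurable_fun [set: 'rV[R]_n.+1] (@row_uncons n).
Proof.
apply: measurable_fun_pair; first exact: measurable_coord.
apply: measurable_fun_coord => i /=.
under eq_fun do rewrite mxE.
exact: measurable_coord.
Qed.

Section step.
Variables (n : nat) (m : {sigma_finite_measure set 'rV[R]_n -> \bar R}).

Definition lebesgue_rV_step : set 'rV[R]_n.+1 -> \bar R :=
  pushforward (lebesgue_measure \x m)%E (@row_cons n).

Let step0 : lebesgue_rV_step set0 = 0%E.
Proof. by rewrite /lebesgue_rV_step /pushforward preimage_set0 measure0. Qed.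

Let step_ge0 A : (0 <= lebesgue_rV_step A)%E.
Proof. exact: (measure_ge0 (lebesgue_measure \x m)%E). Qed.

Let step_sigma_additive : semi_sigma_additive lebesgue_rV_step.
Proof.
move=> F mF tF mUF; rewrite /lebesgue_rV_step /pushforward preimage_bigcup.
have mrc A : measurable A -> measurable (@row_cons n @^-1` A).
  by move=> mA; rewrite -[X in measurable X]setTI; exact: measurable_row_cons.
apply: measure_semi_sigma_additive.
- by move=> k; exact: mrc.
- apply/trivIsetP => /= i j _ _ ij; rewrite -preimage_setI.
  by move/trivIsetP : tF => /(_ _ _ _ _ ij) ->//; rewrite preimage_set0.
- by rewrite -preimage_bigcup; exact: mrc.
Qed.

HB.instance Definition _ := isMeasure.Build _ _ _
  lebesgue_rV_step step0 step_ge0 step_sigma_additive.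

Let step_sigma_finite : sigma_finite setT lebesgue_rV_step.
Proof.
have /sigma_finiteP[F [TF ndF Foo]] := sigma_finiteT (@lebesgue_measure R).
have /sigma_finiteP[G [TG ndG Goo]] := sigma_finiteT m.
exists (fun k => @row_uncons n @^-1` (F k `*` G k)).
  apply/seteqP; split => // x _.
  have [i _ Fi] : (\bigcup_i F i) (row_uncons x).1 by rewrite -TF.
  have [j _ Gj] : (\bigcup_j G j) (row_uncons x).2 by rewrite -TG.
  exists (maxn i j) => //; split.
    by move: Fi; exact/subsetPset/ndF/leq_maxl.
  by move: Gj; exact/subsetPset/ndG/leq_maxr.
move=> k; have [mF Fk] := Foo k; have [mG Gk] := Goo k; split.
  rewrite -[X in measurable X]setTI; apply: measurable_row_uncons => //.
  exact: measurableX.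
rewrite /lebesgue_rV_step /pushforward (_ : _ @^-1` _ = F k `*` G k).
  rewrite product_measure1E//.
  by apply: lte_mul_pinfty => //; rewrite ge0_fin_numE.
by rewrite -comp_preimage (_ : _ \o _ = id)//; apply/funext => z; exact: row_consK.
Qed.

HB.instance Definition _ := Measure_isSigmaFinite.Build _ _ _
  lebesgue_rV_step step_sigma_finite.

End step.

Fixpoint lebesgue_rV n : {sigma_finite_measure set 'rV[R]_n -> \bar R} :=
  match n with
  | 0 => [the {sigma_finite_measure set 'rV[R]_0 -> \bar R} of
            @dirac _ 'rV[R]_0 0 R]
  | n'.+1 => [the {sigma_finite_measure set 'rV[R]_n'.+1 -> \bar R} of
            lebesgue_rV_step (lebesgue_rV n')]
  end.

Lemma lebesgue_rV_box n (a b : 'rV[R]_n) :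
  (forall i, a ord0 i <= b ord0 i) ->
  lebesgue_rV n [set x | forall i, a ord0 i <= x ord0 i <= b ord0 i] =
  (\prod_(i < n) (b ord0 i - a ord0 i))%:E.
Proof.
elim: n a b => [|n IHn] a b ab.
  rewrite big_ord0 /= diracE mem_set//= => -[].
  by case.
rewrite big_ord_recl EFinM.
pose a' := (row_uncons a).2; pose b' := (row_uncons b).2.
have ab' i : a' ord0 i <= b' ord0 i by rewrite !mxE.
have <- : \prod_(i < n) (b' ord0 i - a' ord0 i) =
    \prod_(i < n) (b ord0 (lift ord0 i) - a ord0 (lift ord0 i)).
  by apply: eq_bigr => i _; rewrite !mxE.
pose B := [set x : 'rV[R]_n | forall i, a' ord0 i <= x ord0 i <= b' ord0 i].
rewrite -(IHn _ _ ab') -/B.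
change ((lebesgue_measure \x lebesgue_rV n)%E (@row_cons n @^-1`
  [set x | forall i, a ord0 i <= x ord0 i <= b ord0 i]) =
  ((b ord0 ord0 - a ord0 ord0)%:E * lebesgue_rV n B)%E).
set A := (X in (_ \x _)%E X).
have mB : measurable B.
  rewrite (_ : B = \big[setI/setT]_(i < n)
      ((fun x : 'rV[R]_n => x ord0 i) @^-1` `[a' ord0 i, b' ord0 i])).
    apply: bigsetI_measurable => i _; rewrite -[X in measurable X]setTI.
    exact: measurable_coord.
  rewrite -bigcap_seq; apply/seteqP; split => x /= Bx i.
    by move=> _; rewrite /= in_itv/=; exact: Bx.
  by have := Bx i; rewrite /= in_itv/= mem_index_enum; apply.
rewrite (_ : A = `[a ord0 ord0, b ord0 ord0] `*` B).
  rewrite product_measure1E//= lebesgue_measure_itv/= lte_fin.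
  case: ltP => // ba; rewrite (_ : b ord0 ord0 = a ord0 ord0) ?subrr//.
  by apply/eqP; rewrite eq_le ba ab.
apply/seteqP; split => -[t x] /=.
  move=> Ax; split; first by have := Ax ord0; rewrite row_cons0 in_itv.
  by move=> i; have := Ax (lift ord0 i); rewrite row_consS !mxE.
rewrite in_itv/= => -[tab Bx] i; case: (unliftP ord0 i) => [j ->|->].
  by have := Bx j; rewrite row_consS !mxE.
by rewrite row_cons0.
Qed.

End lebesgue_rV.

Section function_spaces.
Context {R : realType} {n : nat}.
Implicit Types (t s rho : R) (x : 'rV[R]_n) (T : \bar R).

Local Notation leb := (lebesgue_rV n).

(* Matrices carry the sup norm in the library, so the Euclidean norm is spelled
   out. *)
Definition eball rho : set 'rV[R]_n :=
  [set x | Num.sqrt (\sum_(i < n) x ord0 i ^+ 2) <= rho].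

(* Support of a class of a.e. equal functions: the smallest closed set outside
   which the function vanishes almost everywhere. *)
Definition esupp (g : 'rV[R]_n -> R) : set 'rV[R]_n :=
  [set x | forall F : set 'rV[R]_n, closed F ->
     {ae leb, forall y, ~ F y -> g y = 0} -> F x].

Definition L1loc (g : 'rV[R]_n -> R) : Prop :=
  measurable_fun [set: 'rV[R]_n] g /\
  forall K : set 'rV[R]_n, compact K -> leb.-integrable K (EFin \o g).

Definition itv0 T : set R := [set t | 0 <= t /\ (t%:E < T)%E].

Definition C0_L1loc T (v : R -> 'rV[R]_n -> R) : Prop :=
  (forall t, itv0 T t -> L1loc (v t)) /\
  forall (K : set 'rV[R]_n) t, compact K -> itv0 T t ->
    (\int[leb]_(x in K) `|v s x - v t x|%:E)%E
      @[s --> within (itv0 T) (nbhs t)] --> 0%E.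

(* Elements of L^1_loc are handled through real-valued representatives.
   u is in C^1([0,T), L^1_loc) with time derivative ut; the difference quotients
   converge in L^1(K) for every compact K, one-sidedly at t = 0. *)
Definition C1_L1loc T (u ut : R -> 'rV[R]_n -> R) : Prop :=
  [/\ C0_L1loc T u, C0_L1loc T ut &
    forall (K : set 'rV[R]_n) t, compact K -> itv0 T t ->
      (\int[leb]_(x in K) `|(s - t)^-1 * (u s x - u t x) - ut t x|%:E)%E
        @[s --> within (itv0 T) (t^')] --> 0%E].

(* L^1_loc((0,T) x R^n), for functions with values in [-oo, +oo]. *)
Definition L1loc_spacetime T (F : R * 'rV[R]_n -> \bar R) : Prop :=
  let D := [set z : R * 'rV[R]_n | 0 < z.1 /\ (z.1%:E < T)%E] in
  measurable_fun D F /\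
  forall K : set (R * 'rV[R]_n), K `<=` D -> compact K ->
    (lebesgue_measure \x leb)%E.-integrable K F.

End function_spaces.

Section test_functions.
Context {R : realType}.

Fixpoint Ck (V : normedModType R) (k : nat) (f : V -> R) : Prop :=
  if k is k'.+1 then
    continuous f /\
    forall v : V, (forall z, derivable f z v) /\ Ck k' (fun z => 'D_v f z)
  else continuous f.

Definition smooth (V : normedModType R) (f : V -> R) : Prop :=
  forall k, Ck k f.

Definition laplacian n (g : 'rV[R]_n -> R) (x : 'rV[R]_n) : R :=
  \sum_(i < n) 'D_(delta_mx ord0 i) (fun y => 'D_(delta_mx ord0 i) g y) x.

(* C_0^oo([0,T) x R^n): functions on [0,T) x R^n, smooth up to t = 0, with
   compact support in [0,T) x R^n (the support may meet t = 0).  Such functions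
   are represented by a smooth extension to R x R^n; only the values on
   [0,T) x R^n enter the support condition. *)
Definition test_function n (T : \bar R) (phi : R -> 'rV[R]_n -> R) : Prop :=
  let D := [set z : R * 'rV[R]_n | 0 <= z.1 /\ (z.1%:E < T)%E] in
  smooth (fun z : R * 'rV[R]_n => phi z.1 z.2) /\
  compact (closure [set z | D z /\ phi z.1 z.2 != 0] `&` D).

End test_functions.

Section semilinear_wave.
Context {R : realType} {n : nat}.
Implicit Types (c H b m beta p mu eps t s : R) (Gamma : R -> R).
Implicit Types (ut phi : R -> 'rV[R]_n -> R).
Implicit Types (x : 'rV[R]_n) (T : \bar R).

Local Notation leb := (lebesgue_rV n).
Local Notation dt phi := (fun s x => 'D_1 (fun r => phi r x) s).

Definition A_dS c H t : R := c / H * (1 - expR (- H * t)).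

(* int |u(t,y)|^p dy, possibly +oo *)
Definition pmass p (u : R -> 'rV[R]_n -> R) t : \bar R :=
  (\int[leb]_y (`|u t y| `^ p)%:E)%E.

Definition nonlinearity Gamma beta p (u : R -> 'rV[R]_n -> R)
    (z : R * 'rV[R]_n) : \bar R :=
  ((Gamma z.1)%:E * (pmass p u z.1) `^ beta * (`|u z.1 z.2| `^ p)%:E)%E.

Definition adjoint_operator c H b m2 phi s x : R :=
  dt (dt phi) s x - c ^+ 2 * expR (- 2 * H * s) * laplacian (phi s) x
  - b * dt phi s x + m2 * phi s x.

(* All integrals take values in \bar R: since the other terms are finite, the
   identity forces the nonlinear term to be finite. *)
Definition weak_identity c H b m2 beta p Gamma eps
    (u0 u1 : 'rV[R]_n -> R) (u : R -> 'rV[R]_n -> R) ut phi t : Prop :=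
  ((\int[leb]_x (ut t x * phi t x)%:E - \int[leb]_x (u t x * dt phi t x)%:E
    + b%:E * \int[leb]_x (u t x * phi t x)%:E
    + \int[lebesgue_measure]_(s in `[0%R, t])
        \int[leb]_x (u s x * adjoint_operator c H b m2 phi s x)%:E)
  = eps%:E * \int[leb]_x (u1 x * phi 0%R x)%:E
    + eps%:E * \int[leb]_x (u0 x * (b * phi 0%R x - dt phi 0%R x))%:E
    + \int[lebesgue_measure]_(s in `[0%R, t])
        ((Gamma s)%:E * (pmass p u s) `^ beta
         * \int[leb]_x (`|u s x| `^ p * phi s x)%:E))%E.

Definition weak_solution c H b m2 beta p Gamma eps
    (u0 u1 : 'rV[R]_n -> R) (R0 : R) T (u : R -> 'rV[R]_n -> R) : Prop :=
  exists ut,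
  [/\ C1_L1loc T u ut,
      L1loc_spacetime T (nonlinearity Gamma beta p u),
      forall t, 0 < t -> (t%:E < T)%E ->
        esupp (u t) `<=` eball (R0 + A_dS c H t) &
      forall t phi, 0 < t -> (t%:E < T)%E -> test_function T phi ->
        weak_identity c H b m2 beta p Gamma eps u0 u1 u ut phi t].

(* u is a weak solution on [0,T) and T is its lifespan (maximal existence time):
   u is not the restriction of a weak solution on a larger interval. *)
Definition weak_solution_with_lifespan c H b m2 beta p Gamma eps
    (u0 u1 : 'rV[R]_n -> R) (R0 : R) T (u : R -> 'rV[R]_n -> R) : Prop :=
  [/\ (0 < T)%E,
      weak_solution c H b m2 beta p Gamma eps u0 u1 R0 T u &
      forall T' v, (T < T')%E ->
        weak_solution c H b m2 beta p Gamma eps u0 u1 R0 T' v ->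
        ~ forall t, itv0 T t -> {ae leb, forall x, v t x = u t x}].

Definition r_crit b m2 beta p : R :=
  2^-1 * (b - Num.sqrt (b ^+ 2 - 4 * m2)) * ((beta + 1) * p - 1).

Definition kappa_crit b m2 beta p : R :=
  if 4 * m2 < b ^+ 2 then -1 else - 1 - (beta + 1) * p.

Definition Gamma_crit b m2 beta p mu t : R :=
  mu * expR (r_crit b m2 beta p * t) * (1 + t) `^ kappa_crit b m2 beta p.

End semilinear_wave.

(* Main.v *)
Require Import Defs.
From mathcomp Require Import all_boot all_order all_algebra.
From mathcomp Require Import all_classical all_reals all_analysis.
From mathcomp Require Import measurable_realfun.
From mathcomp Require Import ring lra.

Import Order.TTheory GRing.Theory Num.Theory.
Import numFieldNormedType.Exports.

Local Open Scope classical_set_scope.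
Local Open Scope ring_scope.

(** The proof tests the weak identity at time [t] with a single function: the
    solution, backwards in time from [t], of the ordinary differential equation
    adjoint to [y'' + b y' + m2 y = 0], multiplied by a spatial cut-off equal to
    [1] near the support of [u]. That support stays in a fixed ball since
    [A_dS t <= c / H], so the Laplacian never contributes. The test function
    vanishes at time [t] with slope [-1], and the identity becomes Duhamel's
    formula for the spatial average [U] of [u] ([duhamel_formula]):
    [U t = eps * (data) + \int_0^t y (t - s) * F s ds], with [F] the space
    integral of the nonlinearity. This formula contains no derivative of [u], and
    all its terms are nonnegative.

    By Jensen's inequality ([jensen_cutoff]) [F s] is at least a multiple of
    [Gamma s * U s `^ q] with [q = (beta + 1) * p]. Let [l] and [l + d] be the
    decay rates of the homogeneous equation, and let
    [Z t = U t * expR (l * t) / weight d t], where [weight d t] is [1], or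
    [1 + t] for a double root. The exponents of [Gamma_crit] are exactly those
    for which all growth factors cancel ([critical_balance]), and in both cases
    [Z t] is bounded below by [a * eps] ([data_lower_bound]) and by a multiple
    of [\int_0^t (t - s) / (1 + t) / (1 + s) * Z s `^ q ds] ([feedback]).

    In the variable [ln (1 + t)] this is an autonomous inequality. A lower bound
    [m] on [Z] doubles after an increase of [ln (1 + t)] of order
    [m `^ (1 - q)] when [m] is small, and of order the square root of that when
    [m] is large. Starting from [m = a * eps], the costs of the successive
    doublings are dominated by a geometric series with sum of order
    [eps `^ (1 - q)], and beyond this value of [ln (1 + t)] the function [Z]
    would be infinite ([lifespan_bound]). The iteration handles [Z] through
    pointwise lower bounds, so monotonicity is the only property of the time
    integral of [F] that it relies on ([ge0_le_lower_integral]). *)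

(** * Iterated differentiability *)

Lemma Ck_continuous {R : realType} {V : normedModType R} k (f : V -> R) :
  Ck k f -> continuous f.
Proof. by case: k => // k []. Qed.

Lemma CkW {R : realType} {V : normedModType R} k (f : V -> R) :
  Ck k.+1 f -> Ck k f.
Proof.
elim: k f => [|k IHk] f; first by case.
by move=> [cf df]; split=> // v; have [dfv /IHk] := df v.
Qed.

Lemma Ck_cst {R : realType} {V : normedModType R} k (a : R) :
  Ck k (fun _ : V => a).
Proof.
elim: k a => [|k IHk] a /=; first exact: cst_continuous.
split; first exact: cst_continuous.
move=> v; split=> [z|]; first exact: derivable_cst.
have -> : (fun z => 'D_v (fun _ : V => a) z) = fun=> 0; last exact: IHk.
by apply/funext => z; exact: derive_cst.
Qed.

Lemma CkD {R : realType} {V : normedModType R} k (f g : V -> R) :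
  Ck k f -> Ck k g -> Ck k (fun z => f z + g z).
Proof.
elim: k f g => [|k IHk] f g /= Cf Cg.
  by move=> z; apply: cvgD; [exact: Cf|exact: Cg].
case: Cf Cg => cf df [cg dg]; split=> [z|v].
  by apply: cvgD; [exact: cf|exact: cg].
have [dfv Cfv] := df v; have [dgv Cgv] := dg v; split=> [z|].
  exact: derivableD.
have -> : (fun z => 'D_v (fun z => f z + g z) z) =
    fun z => 'D_v f z + 'D_v g z.
  by apply/funext => z; exact: deriveD.
exact: IHk.
Qed.

Lemma CkM {R : realType} {V : normedModType R} k (f g : V -> R) :
  Ck k f -> Ck k g -> Ck k (fun z => f z * g z).
Proof.
elim: k f g => [|k IHk] f g /= Cf Cg.
  by move=> z; apply: cvgM; [exact: Cf|exact: Cg].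
have Cf' := CkW _ _ Cf; have Cg' := CkW _ _ Cg.
case: Cf Cg => cf df [cg dg]; split=> [z|v].
  by apply: cvgM; [exact: cf|exact: cg].
have [dfv Cfv] := df v; have [dgv Cgv] := dg v; split=> [z|].
  exact: derivableM.
have -> : (fun z => 'D_v (fun z => f z * g z) z) =
    fun z => f z * 'D_v g z + g z * 'D_v f z.
  by apply/funext => z; exact: deriveM.
by apply: CkD; exact: IHk.
Qed.

Lemma CkV {R : realType} {V : normedModType R} k (f : V -> R) :
  (forall z, f z != 0) -> Ck k f -> Ck k (fun z => (f z)^-1).
Proof.
move=> f0; elim: k => [|k IHk] /= Cf.
  by move=> z; apply: cvgV => //; exact: Cf.
have {}IHk := IHk (CkW _ _ Cf).
case: Cf => cf df; split=> [z|v].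
  by apply: cvgV => //; exact: cf.
have [dfv Cfv] := df v; split=> [z|]; first exact: derivableV.
have -> : (fun z => 'D_v (fun z => (f z)^-1) z) =
    fun z => -1 * ((f z)^-1 * (f z)^-1) * 'D_v f z.
  by apply/funext => z; rewrite deriveV// mulN1r -invfM -expr2.
by apply: CkM => //; apply: CkM; [exact: Ck_cst|exact: CkM].
Qed.

Lemma Ck_prod {R : realType} {V : normedModType R} k (I : Type) (s : seq I)
    (f : I -> V -> R) :
  (forall i, Ck k (f i)) -> Ck k (fun z => \prod_(i <- s) f i z).
Proof.
move=> Cf; elim: s => [|i s IHs].
  by under eq_fun do rewrite big_nil; exact: Ck_cst.
by under eq_fun do rewrite big_cons; exact: CkM.
Qed.

(** An affine map [l] with linear part [L] turns a directional derivative into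
    the one along the image of the direction under [L]: the two families of
    difference quotients are the same functions. *)
Lemma Ck_affine {R : realType} {V W : normedModType R} k (g : W -> R)
    (l L : V -> W) :
  continuous l -> (forall (h : R) v z, l (h *: v + z) = h *: L v + l z) ->
  Ck k g -> Ck k (fun z => g (l z)).
Proof.
move=> cl lL; elim: k g => [|k IHk] g /= Cg.
  by move=> z; apply: continuous_comp; [exact: cl|exact: Cg].
case: Cg => cg dg; split=> [z|v].
  by apply: continuous_comp; [exact: cl|exact: cg].
have E z : (fun h : R => h^-1 *: (((fun z => g (l z)) \o shift z) (h *: v)
    - g (l z))) =
    fun h : R => h^-1 *: ((g \o shift (l z)) (h *: L v) - g (l z)).
  by apply/funext => h /=; rewrite lL.
have [dgv Cgv] := dg (L v); split=> [z|].
  by rewrite /derivable E; exact: dgv.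
have -> : (fun z => 'D_v (fun z => g (l z)) z) = fun z => 'D_(L v) g (l z).
  by apply/funext => z; rewrite /derive E.
exact: (IHk (fun w => 'D_(L v) g w)).
Qed.

Lemma Ck_coordinate {R : realType} {n : nat} k (g : R -> R) (i : 'I_n) :
  Ck k g -> Ck k (fun x : 'rV[R]_n => g (x ord0 i)).
Proof.
pose co := fun x : 'rV[R]_n => x ord0 i.
apply: (@Ck_affine _ _ _ k g co co); first exact: coord_continuous.
by move=> h v z; rewrite /co !mxE.
Qed.

(** A real function has the derivative [v * f'] in direction [v], so only the
    direction [1] has to be examined. *)
Lemma CkS_real {R : realType} k (f f' : R -> R) :
  (forall x : R, is_derive x 1 f (f' x)) -> Ck k f' -> Ck k.+1 f.
Proof.
move=> ff' Cf'; have df x : differentiable f x.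
  by apply/derivable1_diffP; have [] := ff' x.
split=> [x|v]; first exact/differentiable_continuous/df.
split=> [x|]; first exact/diff_derivable/df.
have -> : (fun z => 'D_v f z) = fun z => v * f' z; last first.
  by apply: CkM => //; exact: Ck_cst.
apply/funext => x; rewrite deriveE// -[v in 'd f x v]mulr1 -[v * 1]/(v *: 1).
by rewrite linearZ -deriveE//; have [_ ->] := ff' x.
Qed.

Lemma Ck_expR {R : realType} k (a : R) : Ck k (fun x : R => expR (a * x)).
Proof.
elim: k => [|k IHk].
  move=> x; apply: continuous_comp; last exact: continuous_expR.
  exact: mulrl_continuous.
apply: (@CkS_real _ _ _ (fun x => a * expR (a * x))).
  by move=> x; apply: is_derive_eq; rewrite /GRing.scale/= ?(mulr1, mulr0, addr0) mulrC.
by apply: CkM => //; exact: Ck_cst.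
Qed.

Lemma Ck_id {R : realType} k : Ck k (fun x : R => x).
Proof.
case: k => [|k]; first by move=> x; exact: cvg_id.
by apply: (@CkS_real _ _ _ (fun=> 1)); exact: Ck_cst.
Qed.

(** * A smooth step *)

(** The derivative of a flat function is again a combination of flat functions,
    which makes the whole family smooth at once. *)
Definition flat {R : realType} (m : nat) (x : R) : R :=
  if 0 < x then x^-1 ^+ m * expR (- x^-1) else 0.

Lemma flat_ge0 {R : realType} m (x : R) : 0 <= flat m x.
Proof.
rewrite /flat; case: ifP => // x0.
by rewrite mulr_ge0 ?expR_ge0// exprn_ge0// invr_ge0 ltW.
Qed.

Lemma flat_le0 {R : realType} m (x : R) : x <= 0 -> flat m x = 0.
Proof. by rewrite /flat ltNge => ->. Qed.

Lemma flat0_gt0 {R : realType} (x : R) : 0 < x -> 0 < flat 0 x.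
Proof. by rewrite /flat => ->; rewrite expr0 mul1r expR_gt0. Qed.

(** The exponential beats every power: [expR y] is at least
    [y ^+ m.+1 / m.+1`!] at [y = x^-1]. *)
Lemma flat_lipschitz0 {R : realType} m (x : R) :
  `|flat m x| <= m.+1`!%:R * `|x|.
Proof.
have [x0|x0] := leP x 0; first by rewrite flat_le0// normr0 mulr_ge0.
rewrite ger0_norm ?flat_ge0// gtr0_norm// /flat x0 expRN.
have xm0 : 0 < x^-1 ^+ m by rewrite exprn_gt0// invr_gt0.
rewrite ler_pdivrMr ?expR_gt0//.
have : x^-1 ^+ m.+1 / m.+1`!%:R <= expR x^-1.
  by apply: le_trans (expR_ge1Dxn m _); rewrite ?lerDr// invr_ge0 ltW.
rewrite ler_pdivrMr ?ltr0n ?fact_gt0// exprS -ler_pdivlMl ?invr_gt0//.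
by rewrite invrK mulrC (mulrC (expR _)) mulrAC.
Qed.

(** At [0] the difference quotient of [flat m] is [flat m.+1] itself, which
    tends to [0]. *)
Lemma is_derive_flat {R : realType} m (x : R) :
  is_derive x 1 (flat m) (flat m.+2 x - m%:R * flat m.+1 x).
Proof.
have [x0|x0|->] := ltgtP x 0.
- rewrite !flat_le0 ?ltW// mulr0 subr0.
  apply: (@near_eq_is_derive _ _ _ (cst 0)).
  near=> y; rewrite flat_le0//= ltW//; near: y; exact: lt_nbhsl.
- have fE : {near x, (fun y : R => y^-1 ^+ m * expR (- y^-1)) =1 flat m}.
    near=> y; rewrite /flat ifT//; near: y; exact: lt_nbhsr.
  apply: near_eq_is_derive fE _.
  have xN0 : x != 0 by rewrite gt_eqF.
  have dV : is_derive x 1 (fun y : R => y^-1) (- x ^- 2).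
    apply: DeriveDef; first exact: derivableV.
    by rewrite deriveV// derive_id -[_ *: _]/(_ * _) mulr1.
  have dE : is_derive x 1 (fun y : R => expR (- y^-1)) (x ^- 2 * expR (- x^-1)).
    by apply: is_derive_eq; rewrite /GRing.scale/= opprK mulrC.
  have := is_deriveM (is_deriveX m dV) dE; rewrite exprfctE => D.
  apply: (is_derive_eq D); rewrite /GRing.scale/= /flat x0 -!exprVn.
  move: (x^-1) (expR _) => w E.
  by case: m {D} => [|m] /=; rewrite ?(exprS _ m.+2) ?(exprS _ m.+1) ?(exprS _ m); ring.
- rewrite !flat_le0// mulr0 subr0.
  have D : (h^-1 *: (flat m (h *: 1 + 0) - flat m 0) : R) @[h --> (0:R)^'] --> (0 : R).
    apply/cvgrPdist_lt => e e0; near=> h.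
    have h0 : h != 0 by near: h; exact: nbhs_dnbhs_neq.
    have -> : h^-1 *: (flat m (h *: 1 + 0) - flat m 0) = flat m.+1 h.
      rewrite (flat_le0 m 0)// subr0 addr0 -[_ *: 1]/(_ * _) mulr1.
      rewrite -[LHS]/(_ * _) /flat; case: ifP => _; last by rewrite mulr0.
      by rewrite mulrA exprS.
    rewrite sub0r normrN (le_lt_trans (flat_lipschitz0 _ _))//.
    rewrite mulrC -ltr_pdivlMr ?ltr0n ?fact_gt0//.
    by near: h; apply: dnbhs0_lt; rewrite divr_gt0// ltr0n fact_gt0.
  apply: DeriveDef; first by apply/cvg_ex; exists 0.
  exact: cvg_lim D.
Unshelve. all: by end_near. Qed.

Lemma Ck_flat {R : realType} k m : Ck k (@flat R m).
Proof.
elim: k m => [|k IHk] m.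
  move=> x; apply/differentiable_continuous/derivable1_diffP.
  by have [] := is_derive_flat m x.
apply: CkS_real (is_derive_flat m) _.
have -> : (fun x : R => flat m.+2 x - m%:R * flat m.+1 x) =
    fun x => flat m.+2 x + - m%:R * flat m.+1 x.
  by apply/funext => x; rewrite mulNr.
by apply: CkD => //; apply: CkM => //; exact: Ck_cst.
Qed.

Definition step {R : realType} (x : R) : R :=
  flat 0 x * (flat 0 x + flat 0 (1 - x))^-1.

(** The points [x] and [1 - x] cannot both be nonpositive. *)
Lemma step_den_gt0 {R : realType} (x : R) : 0 < flat 0 x + flat 0 (1 - x).
Proof.
have [x0|x0] := leP x 0.
  by rewrite ltr_wpDl ?flat_ge0// flat0_gt0// subr_gt0 (le_lt_trans x0).
by rewrite ltr_pwDl ?flat_ge0 ?flat0_gt0.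
Qed.

Lemma step_ge0 {R : realType} (x : R) : 0 <= step x.
Proof. by rewrite mulr_ge0 ?flat_ge0// invr_ge0 ltW// step_den_gt0. Qed.

Lemma step_le1 {R : realType} (x : R) : step x <= 1.
Proof.
by rewrite /step -[_ * _^-1]/(_ / _) ler_pdivrMr ?step_den_gt0// mul1r lerDl
  flat_ge0.
Qed.

Lemma step_eq0 {R : realType} (x : R) : x <= 0 -> step x = 0.
Proof. by move=> x0; rewrite /step flat_le0// mul0r. Qed.

Lemma step_eq1 {R : realType} (x : R) : 1 <= x -> step x = 1.
Proof.
move=> x1; rewrite /step (flat_le0 _ (1 - x)) ?subr_le0// addr0 mulfV//.
by rewrite gt_eqF// flat0_gt0// (lt_le_trans _ x1).
Qed.

Lemma Ck_step_affine {R : realType} k (a e : R) :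
  Ck k (fun x : R => step (a * x + e)).
Proof.
apply: (@Ck_affine _ _ _ k step (fun x : R => a * x + e) (fun x => a * x)).
- move=> x; apply: cvgD; last exact: cvg_cst.
  exact: mulrl_continuous.
- by move=> h v z; rewrite /GRing.scale/=; ring.
apply: CkM; first exact: Ck_flat.
apply: CkV => [x|]; first by rewrite gt_eqF// step_den_gt0.
apply: CkD; first exact: Ck_flat.
apply: (@Ck_affine _ _ _ k (flat 0) (fun x : R => 1 - x) (fun x => - x)).
- by move=> x; apply: cvgB; [exact: cvg_cst|exact: cvg_id].
- by move=> h v z; rewrite /GRing.scale/=; ring.
exact: Ck_flat.
Qed.

(** * Spatial cut-offs *)

Definition box {R : realType} {n : nat} (r : R) : set 'rV[R]_n :=
  [set x | forall i, `|x ord0 i| <= r].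

Definition cutoff {R : realType} {n : nat} (r : R) (x : 'rV[R]_n) : R :=
  \prod_(i < n) (step (x ord0 i + (r + 1)) * step (- x ord0 i + (r + 1))).

Lemma cutoff_ge0 {R : realType} {n : nat} (r : R) (x : 'rV[R]_n) :
  0 <= cutoff r x.
Proof. by apply: prodr_ge0 => i _; rewrite mulr_ge0// step_ge0. Qed.

Lemma cutoff_le1 {R : realType} {n : nat} (r : R) (x : 'rV[R]_n) :
  cutoff r x <= 1.
Proof.
have -> : 1 = \prod_(i < n) 1 :> R by rewrite big1.
apply: ler_prod => i _; by rewrite mulr_ge0 ?step_ge0//= mulr_ile1 ?step_ge0 ?step_le1.
Qed.

Lemma cutoff_eq1 {R : realType} {n : nat} (r : R) (x : 'rV[R]_n) :
  box r x -> cutoff r x = 1.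
Proof.
move=> rx; rewrite /cutoff big1// => i _.
by have := rx i; rewrite ler_norml => /andP[? ?]; rewrite !step_eq1 ?mulr1//; lra.
Qed.

Lemma cutoff_eq0 {R : realType} {n : nat} (r : R) (x : 'rV[R]_n) :
  ~ box (r + 1) x -> cutoff r x = 0.
Proof.
move=> /existsNP[i /negP]; rewrite -ltNge => rx; apply/eqP/prodf_eq0; exists i => //.
have [x0|x0] := leP 0 (x ord0 i).
  by rewrite (step_eq0 (- _ + _)) ?mulr0//; move: rx; rewrite ger0_norm//; lra.
by rewrite step_eq0 ?mul0r//; move: rx; rewrite ltr0_norm//; lra.
Qed.

Lemma Ck_cutoff {R : realType} {n : nat} k (r : R) :
  Ck k (fun x : 'rV[R]_n => cutoff r x).
Proof.
apply: Ck_prod => i.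
apply: (@Ck_coordinate _ _ k
  (fun y => step (y + (r + 1)) * step (- y + (r + 1)))).
have E (e : R) : (fun y => step (y + e)) = fun y => step (1 * y + e).
  by apply/funext => y; rewrite mul1r.
have EN (e : R) : (fun y => step (- y + e)) = fun y => step ((-1) * y + e).
  by apply/funext => y; rewrite mulN1r.
by apply: CkM; [rewrite E|rewrite EN]; exact: Ck_step_affine.
Qed.

Lemma near_box {R : realType} {n : nat} (r : R) (x : 'rV[R]_n) :
  box r x -> \forall y \near x, box (r + 1) y.
Proof.
move=> rx; near=> y => i.
have xy : ball x 1 y by near: y; exact: nbhsx_ballx.
have {xy} : ball (x ord0 i) 1 (y ord0 i) by case: xy => _; exact.
rewrite -ball_normE /ball_/=.
have := rx i; rewrite !ler_norml ltr_norml => /andP[? ?] /andP[? ?].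
by apply/andP; split; lra.
Unshelve. all: by end_near. Qed.

Lemma compact_box {R : realType} {n : nat} (r : R) : compact (@box R n r).
Proof.
have -> : @box R n r = [set v | forall i, `[- r, r]%classic (v ord0 i)].
  by apply/seteqP; split=> v vr i; have := vr i; rewrite /= in_itv/= ler_norml.
by apply: (@rV_compact _ _ (fun=> `[- r, r]%classic)) => i; exact: segment_compact.
Qed.

(** * The backward solution of the adjoint equation *)

(** [ramp d] solves [g' = expR (- d * x)], [g 0 = 0]: the two cases are the
    distinct and the double characteristic root. *)
Definition ramp {R : realType} (d x : R) : R :=
  if d == 0 then x else (1 - expR (- d * x)) / d.

Lemma ramp0 {R : realType} (d : R) : ramp d 0 = 0.
Proof. by rewrite /ramp; case: ifP => // _; rewrite mulr0 expR0 subrr mul0r. Qed.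

Lemma is_derive_expRM {R : realType} (a x : R) :
  is_derive x 1 (fun y => expR (a * y)) (a * expR (a * x)).
Proof.
by apply: is_derive_eq; rewrite /GRing.scale/= ?(mulr1, mulr0, addr0) mulrC.
Qed.

Lemma is_derive_ramp {R : realType} (d x : R) :
  is_derive x 1 (ramp d) (expR (- d * x)).
Proof.
rewrite /ramp; have [->|d0] := eqVneq d 0.
  by rewrite oppr0 mul0r expR0; exact: is_derive_id.
have D := is_derive_expRM (- d) x.
have -> : (fun y => (1 - expR (- d * y)) / d) =
    (cst 1 - fun y => expR (- d * y)) * cst d^-1 by [].
apply: is_derive_eq; rewrite /GRing.scale/=.
by field.
Qed.

(** When [b = d + 2 * l] and [m2 = l * (l + d)], this is the solution of
    [y'' + b y' + m2 y = 0], [y 0 = 0], [y' 0 = 1]: the characteristic roots are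
    [- l] and [- l - d]. *)
Definition propagator {R : realType} (l d x : R) : R :=
  expR (- l * x) * ramp d x.

Definition propagator' {R : realType} (l d x : R) : R :=
  expR (- l * x) * (expR (- d * x) - l * ramp d x).

Definition propagator'' {R : realType} (l d x : R) : R :=
  expR (- l * x) * (l ^+ 2 * ramp d x - (d + 2 * l) * expR (- d * x)).

Lemma is_derive_propagator {R : realType} (l d x : R) :
  is_derive x 1 (propagator l d) (propagator' l d x).
Proof.
have E := is_derive_expRM (- l) x; have D := is_derive_ramp d x.
have -> : propagator l d = (fun y => expR (- l * y)) * ramp d by [].
apply: is_derive_eq; rewrite /GRing.scale/= /propagator'; ring.
Qed.

Lemma is_derive_propagator' {R : realType} (l d x : R) :
  is_derive x 1 (propagator' l d) (propagator'' l d x).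
Proof.
have E := is_derive_expRM (- l) x; have D := is_derive_ramp d x.
have F := is_derive_expRM (- d) x.
have -> : propagator' l d = (fun y => expR (- l * y)) *
  ((fun y => expR (- d * y)) - cst l * ramp d) by [].
apply: is_derive_eq; rewrite /GRing.scale/= /propagator''.
have -> : ((fun y => expR (- d * y)) - cst l * ramp d) x =
  expR (- d * x) - l * ramp d x by [].
ring.
Qed.

Lemma Ck_propagator {R : realType} k (l d : R) : Ck k (propagator l d).
Proof.
apply: CkM; first exact: Ck_expR.
have [d0|d0] := boolP (d == 0).
  by rewrite /ramp d0; exact: Ck_id.
rewrite /ramp (negPf d0).
apply: CkM; last exact: Ck_cst.
have -> : (fun x => 1 - expR (- d * x)) = fun x => 1 + (-1) * expR (- d * x).
  by apply/funext => x; rewrite mulN1r.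
apply: CkD; first exact: Ck_cst.
by apply: CkM; [exact: Ck_cst|exact: Ck_expR].
Qed.

(** On [[0, t]] and for [x] in the box this is a function of time alone that
    solves the adjoint equation. It vanishes at time [t] with slope [-1], so the
    weak identity at [t] returns the average of [u t] itself, with no time
    derivative of [u] left. The step in time and the cut-off in space only make
    the support compact. *)
Definition duhamel_test {R : realType} {n : nat} (l d t e r s : R)
    (x : 'rV[R]_n) : R :=
  propagator l d (t - s) * step ((t + 2 * e - s) / e) * cutoff r x.

Section duhamel_test.
Context {R : realType} {n : nat}.
Variables (l d t e r : R).
Hypothesis e0 : 0 < e.
Local Notation phi := (@duhamel_test R n l d t e r).
Local Notation dt phi := (fun s x => 'D_1 (fun r => phi r x) s).

Lemma duhamel_testE s x : s <= t + e ->
  phi s x = propagator l d (t - s) * cutoff r x.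
Proof.
by move=> st; rewrite /duhamel_test step_eq1 ?mulr1// ler_pdivlMr// mul1r; lra.
Qed.

Lemma is_derive_comp_rev (f f' : R -> R) (s : R) :
  (forall z : R, is_derive z 1 f (f' z)) ->
  is_derive s 1 (fun z => f (t - z)) (- f' (t - s)).
Proof.
move=> df; have dc : is_derive s 1 (fun z : R => t - z) (-1).
  by rewrite -[-1]add0r; apply: is_deriveD.
have := @is_derive1_comp _ f (fun z : R => t - z) s _ _ (df (t - s)) dc.
by move=> H; apply: is_derive_eq H _; rewrite mulrN1.
Qed.

Lemma dt_duhamel_test s x : s < t + e ->
  dt phi s x = - propagator' l d (t - s) * cutoff r x.
Proof.
move=> st /=; rewrite (@near_eq_derive _ _ _ _
  (fun s => propagator l d (t - s) * cutoff r x)); last first.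
  near=> z; apply: duhamel_testE; apply: ltW; near: z; exact: lt_nbhsl.
have D := is_derive_comp_rev _ _ s (is_derive_propagator l d).
have : is_derive s 1 ((fun z => propagator l d (t - z)) * cst (cutoff r x))
   (- propagator' l d (t - s) * cutoff r x).
  by apply: is_derive_eq; rewrite /GRing.scale/= mulr0 add0r mulrC.
by case.
Unshelve. all: by end_near. Qed.

Lemma dtt_duhamel_test s x : s < t + e ->
  dt (dt phi) s x = propagator'' l d (t - s) * cutoff r x.
Proof.
move=> st /=; rewrite (@near_eq_derive _ _ _ _
  (fun s => - propagator' l d (t - s) * cutoff r x)); last first.
  near=> z; apply: dt_duhamel_test; near: z; exact: lt_nbhsl.
have D := is_derive_comp_rev _ _ s (is_derive_propagator' l d).
have : is_derive s 1 (- (fun z => propagator' l d (t - z)) * cst (cutoff r x))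
   (propagator'' l d (t - s) * cutoff r x).
  by apply: is_derive_eq; rewrite /GRing.scale/= mulr0 add0r opprK mulrC.
by case.
Unshelve. all: by end_near. Qed.

Lemma laplacian_duhamel_test s x : box (r - 1) x -> laplacian (phi s) x = 0.
Proof.
move=> rx; rewrite /laplacian big1// => i _.
have E (h : 'rV[R]_n -> R) a y : (\near y, h y = a) ->
    'D_(delta_mx ord0 i) h y = 0.
  by move=> ha; rewrite (@near_eq_derive _ _ _ _ (cst a)) ?derive_cst.
apply: (E _ 0); have := near_box (r - 1) x rx; rewrite subrK => /near_join.
apply: filterS => y /= ry.
apply: (E _ (propagator l d (t - s) * step ((t + 2 * e - s) / e))).
by apply: filterS ry => z rz; rewrite /duhamel_test cutoff_eq1// mulr1.
Qed.

(** The support lies in [[0, t + 2 * e]] times a box, and [t + 2 * e] is still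
    below [T]. *)
Lemma test_function_duhamel (T : \bar R) : 0 < t ->
  ((t + 2 * e)%:E < T)%E -> test_function T phi.
Proof.
move=> t0 teT; split=> [k|].
  apply: CkM; last first.
    apply: (@Ck_affine _ _ _ k (cutoff r) (fun z : R * 'rV[R]_n => z.2)
      (fun z => z.2)) => //; last exact: Ck_cutoff.
    by move=> z; exact: cvg_snd.
  apply: (@Ck_affine _ _ _ k (fun s => propagator l d (t - s) *
    step ((t + 2 * e - s) / e)) (fun z : R * 'rV[R]_n => z.1) (fun z => z.1)).
  - by move=> z; exact: cvg_fst.
  - by [].
  apply: CkM.
    apply: (@Ck_affine _ _ _ k (propagator l d) (fun s : R => t - s) -%R).
    - by move=> z; apply: cvgB; [exact: cvg_cst|exact: cvg_id].
    - by move=> h v z; rewrite /GRing.scale/=; ring.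
    exact: Ck_propagator.
  have -> : (fun s => step ((t + 2 * e - s) / e)) =
      fun s => step (- e^-1 * s + (t + 2 * e) / e).
    by apply/funext => s; congr step; ring.
  exact: Ck_step_affine.
set A := [set z : R * _ | _]; set D := [set z : R * _ | _].
pose K : set (R * 'rV[R]_n) := `[0, t + 2 * e] `*` box (r + 1).
have cK : compact K by apply: compact_setX; [exact: segment_compact|exact: compact_box].
have AK : A `<=` K.
  move=> [s x] [[/= s0 _] phi0]; split=> /=.
    rewrite in_itv/= s0/= leNgt; apply/negP => ts.
    move: phi0; rewrite /duhamel_test (step_eq0 (_ / _)) ?mulr0 ?mul0r ?eqxx//.
    by rewrite ler_pdivrMr// mul0r; lra.
  have [//|/cutoff_eq0 c0] := pselect (box (r + 1) x).
  by move: phi0; rewrite /duhamel_test c0 mulr0 eqxx.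
have clAK : closure A `<=` K.
  rewrite (_ : K = closure K); first exact: closureS.
  by apply/closure_id; apply: compact_closed cK; exact: norm_hausdorff.
have -> : closure A `&` D = closure A.
  apply/setIidl => z /clAK[]; rewrite /= in_itv/= => /andP[z0 zt] _; split=> //.
  by apply: le_lt_trans teT; rewrite lee_fin.
by apply: subclosed_compact cK clAK; exact: closed_closure.
Qed.

End duhamel_test.

(** * Integrals of functions that need not be measurable *)

(** The integral of a nonnegative function is the supremum of the integrals of
    the simple functions below it, hence monotone without measurability. This
    lets the source term of the weak identity be bounded below at each time
    separately. *)
Lemma ge0_le_lower_integral {d} {T : measurableType d} {R : realType}
    (mu : {measure set T -> \bar R}) (D : set T) (f g : T -> \bar R) :
  (forall x, D x -> 0 <= f x)%E -> (forall x, D x -> f x <= g x)%E ->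
  (\int[mu]_(x in D) f x <= \int[mu]_(x in D) g x)%E.
Proof.
move=> f0 fg; have g0 x : D x -> (0 <= g x)%E.
  by move=> Dx; exact: le_trans (f0 x Dx) (fg x Dx).
rewrite !ge0_integralE//; apply: ereal_sup_le => _ [h hf <-]; exists h => // x.
by apply: le_trans (hf x) _; exact: lee_restrict.
Qed.

(** The positive and negative parts are below the function equal to [+oo] on
    a null set and to [0] elsewhere. *)
Lemma ae0_lower_integral {d} {T : measurableType d} {R : realType}
    (mu : {measure set T -> \bar R}) (D : set T) (f : T -> \bar R) :
  {ae mu, forall x, D x -> f x = 0%E} -> (\int[mu]_(x in D) f x = 0)%E.
Proof.
move=> [A [mA A0 Af]].
have part (g : T -> \bar R) : (forall x, 0 <= g x)%E ->
    (forall x, ~ A x -> D x -> g x = 0%E) -> (\int[mu]_(x in D) g x = 0)%E.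
  move=> g0 gA; apply/eqP; rewrite eq_le integral_ge0// andbT.
  rewrite integral_mkcond (_ : g \_ D = (g \_ D) \_ A); last first.
    apply/funext => x; rewrite [RHS]patchE; case: ifPn => //.
    rewrite notin_setE => nAx; rewrite patchE; case: ifPn => // /set_mem Dx.
    exact: gA.
  rewrite -integral_mkcond.
  apply: le_trans (ge0_le_lower_integral mu A _ (cst +oo%E) _ _) _.
  - by move=> x _; apply: erestrict_ge0.
  - by move=> x _; exact: leey.
  by rewrite integral_cst// A0 mule0.
have fA x : ~ A x -> D x -> f x = 0%E.
  by move=> nAx; apply: contrapT => nf; apply: nAx; exact: Af.
rewrite integralE !part ?sube0// => x.
- by move=> nAx Dx; rewrite funenegE fA// oppe0 maxxx.
- by move=> nAx Dx; rewrite funeposE fA// maxxx.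
Qed.

(** * The essential support *)

(** The complement of the support is a union of null open sets; it is itself
    null because balls with rational centre and radius form a countable base. *)
Lemma esupp_ae {R : realType} {n : nat} (g : 'rV[R]_n -> R) (S : set 'rV[R]_n) :
  esupp g `<=` S -> {ae lebesgue_rV n, forall x, ~ S x -> g x = 0}.
Proof.
move=> gS.
pose B (c : 'rV[rat]_n * nat) : set 'rV[R]_n :=
  [set x | forall i, `|x ord0 i - ratr (c.1 ord0 i)| < c.2.+1%:R^-1].
pose null c := {ae lebesgue_rV n, forall x, B c x -> g x = 0}.
pose F k : set 'rV[R]_n := if unpickle k is Some c then
  [set x | null c /\ B c x /\ g x <> 0] else set0.
apply: (@negligibleS _ _ _ _ (\bigcup_k F k)); last first.
  apply: negligible_bigcup => k; rewrite /F; case: unpickle => [c|]; last first.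
    exact: negligible_set0.
  have [nc|nc] := pselect (null c).
    by apply: negligibleS nc => x [_ [Bx gx]] /(_ Bx).
  rewrite (_ : [set x | _] = set0); first exact: negligible_set0.
  by rewrite -subset0 => x [].
move=> x /= /not_implyP[nSx gx].
have : ~ esupp g x by move=> /gS.
move=> /existsNP[G /not_implyP[cG /not_implyP[Gae nGx]]].
have : nbhs x (~` G) by apply: open_nbhs_nbhs; split=> //; exact: closed_openC.
move=> /nbhs_ballP[e /= e0 xeG].
(* Two points of a ball of radius [w] are less than [2 * w] apart. *)
have [k ke] : exists k : nat, 2 * k.+1%:R^-1 < e.
  exists (Num.truncn (2 / e)); rewrite ltr_pdivrMr ?ltr0n// mulrC -ltr_pdivrMr//.
  exact: truncnS_gt.
have k0 : 0 < k.+1%:R^-1 :> R by rewrite invr_gt0 ltr0n.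
set w : R := k.+1%:R^-1 in ke k0.
have cen i : exists q : rat, `|x ord0 i - ratr q| < w.
  have /rat_in_itvoo[q] : x ord0 i - w < x ord0 i + w by lra.
  rewrite in_itv/= => /andP[? ?]; exists q.
  by rewrite ltr_norml; apply/andP; split; lra.
pose c := (\row_i sval (cid (cen i)), k).
have Bx : B c x by move=> i; rewrite /= mxE; case: cid.
have nc : null c.
  apply: filterS Gae => y gy By; apply: gy; apply: xeG; split=> // i j.
  rewrite ord1 -ball_normE /ball_/=.
  have := By j; have := Bx j; rewrite /= -/w !ltr_norml => /andP[? ?] /andP[? ?].
  by apply/andP; split; lra.
by exists (pickle c) => //; rewrite /F pickleK.
Qed.

Lemma eball_box {R : realType} {n : nat} (r : R) : @eball R n r `<=` box r.
Proof.
move=> x; rewrite /eball/= => xr i; apply: le_trans xr.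
rewrite -sqrtr_sqr ler_wsqrtr// (bigD1 i)//= lerDl sumr_ge0// => j _.
exact: sqr_ge0.
Qed.

Lemma measurable_box {R : realType} {n : nat} (r : R) :
  measurable (@box R n r).
Proof.
rewrite (_ : box r = \big[setI/setT]_(i < n)
    ((fun x : 'rV[R]_n => x ord0 i) @^-1` `[- r, r])).
  apply: bigsetI_measurable => i _; rewrite -[X in measurable X]setTI.
  exact: measurable_coord.
rewrite -bigcap_seq; apply/seteqP; split => x /= rx i.
  by move=> _; rewrite /= in_itv/= -ler_norml; exact: rx.
by have := rx i; rewrite /= in_itv/= mem_index_enum ler_norml; apply.
Qed.

Lemma lebesgue_box_lty {R : realType} {n : nat} (r : R) : 0 <= r ->
  (lebesgue_rV n (@box R n r) < +oo)%E.
Proof.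
move=> r0; rewrite (_ : box r =
    [set x | forall i, (const_mx (- r) : 'rV_n) ord0 i <= x ord0 i <=
                       (const_mx r : 'rV_n) ord0 i]).
  rewrite lebesgue_rV_box ?ltry// => i; rewrite !mxE; lra.
by apply/seteqP; split=> x rx i; have := rx i; rewrite !mxE ler_norml.
Qed.

(** * Averages against the cut-off *)

Definition average {R : realType} {n : nat} (r : R) (v : 'rV[R]_n -> R) :
    \bar R :=
  (\int[lebesgue_rV n]_x (v x * cutoff r x)%:E)%E.

Lemma measurable_cutoff {R : realType} {n : nat} (r : R) :
  measurable_fun [set: 'rV[R]_n] (cutoff r).
Proof.
apply: measurable_prod => i _.
have ms (a e : R) : measurable_fun [set: 'rV[R]_n]
    (fun x : 'rV[R]_n => step (a * x ord0 i + e)).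
  apply: (@measurableT_comp _ _ _ _ _ _ (fun y : R => step (a * y + e))).
    apply: continuous_measurable_fun.
    exact: Ck_continuous (Ck_step_affine 0 _ _).
  exact: measurable_coord.
apply: measurable_funM.
  by have := ms 1 (r + 1); under eq_fun do rewrite mul1r.
by have := ms (-1) (r + 1); under eq_fun do rewrite mulN1r.
Qed.

Lemma integrable_average {R : realType} {n : nat} (r : R) (v : 'rV[R]_n -> R) :
  L1loc v ->
  (lebesgue_rV n).-integrable setT (fun x => (v x * cutoff r x)%:E).
Proof.
move=> [mv iv]; have -> : (fun x => (v x * cutoff r x)%:E) =
    ((EFin \o v) \* (EFin \o cutoff r))%E \_ (box (r + 1)).
  apply/funext => x; rewrite patchE; case: ifPn => [_//|].
  by rewrite notin_setE => /cutoff_eq0 ->; rewrite mulr0.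
apply/(integrable_mkcond _ (measurable_box (r + 1))).
apply: integrableMl.
- by apply: measurable_box.
- exact: iv (compact_box _).
- by apply: measurable_funS (measurable_cutoff r).
exists 1; split=> // y y1 x _ /=.
by rewrite ger0_norm ?cutoff_ge0// (le_trans (cutoff_le1 _ _))// ltW.
Qed.

Lemma average_fin_num {R : realType} {n : nat} (r : R) (v : 'rV[R]_n -> R) :
  L1loc v -> average r v \is a fin_num.
Proof. by move=> /(integrable_average r); exact: integrable_fin_num. Qed.

Lemma averageZ {R : realType} {n : nat} (r a : R) (v : 'rV[R]_n -> R) :
  L1loc v ->
  (\int[lebesgue_rV n]_x (v x * (a * cutoff r x))%:E = a%:E * average r v)%E.
Proof.
move=> Lv; rewrite /average -integralZl//; last exact: integrable_average.
by apply: eq_integral => x _; rewrite -EFinM mulrCA.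
Qed.

(** Young's inequality for [`|x|] and [a `^ (p - 1)]. *)
Lemma powR_ge_tangent {R : realType} (p a x : R) : 1 < p -> 0 < a ->
  p * a `^ (p - 1) * x - (p - 1) * a `^ p <= `|x| `^ p.
Proof.
move=> p1 a0; have p0 : 0 < p by lra.
have q0 : 0 < p / (p - 1) by rewrite divr_gt0// subr_gt0.
have := @conjugate_powR R `|x| (a `^ (p - 1)) p (p / (p - 1)) (normr_ge0 _)
  (powR_ge0 _ _) p0 q0.
rewrite invf_div -powRrM (_ : (p - 1) * (p / (p - 1)) = p); last first.
  by field; lra.
have -> : p^-1 + (p - 1) / p = 1 by field; exact: lt0r_neq0.
move=> /(_ erefl) young.
have : x * a `^ (p - 1) <= `|x| `^ p / p + a `^ p * ((p - 1) / p).
  by apply: le_trans young; rewrite ler_wpM2r ?powR_ge0 ?ler_norm.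
rewrite -(ler_pM2l p0) mulrDr => h.
have e1 : p * (`|x| `^ p / p) = `|x| `^ p by field; exact: lt0r_neq0.
have e2 : p * (a `^ p * ((p - 1) / p)) = (p - 1) * a `^ p.
  by field; exact: lt0r_neq0.
move: h; rewrite e1 e2; lra.
Qed.

(** Jensen's inequality, obtained by integrating the tangent line of the power
    at a multiple of [w]. *)
Lemma jensen_cutoff {R : realType} {n : nat} (r p : R) : 0 <= r -> 1 < p ->
  exists2 k, 0 < k & forall (v : 'rV[R]_n -> R) w, L1loc v -> 0 < w ->
    (w%:E <= average r v)%E ->
    ((k * w `^ p)%:E <= \int[lebesgue_rV n]_x (`|v x| `^ p * cutoff r x)%:E)%E.
Proof.
move=> r0 p1; have r10 : 0 <= r + 1 by lra.
have p0 : 0 < p by lra.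
pose B : set 'rV[R]_n := box (r + 1).
have mB : measurable B := measurable_box _.
have Bfin : lebesgue_rV n B \is a fin_num.
  by rewrite ge0_fin_numE// lebesgue_box_lty.
pose E := fine (lebesgue_rV n B) + 1.
have E0 : 0 < E by rewrite ltr_pwDr// fine_ge0.
exists (E * E^-1 `^ p); first by rewrite mulr_gt0// powR_gt0// invr_gt0.
move=> v w Lv w0 wv.
(* Among all tangent points, [w / E] gives the largest lower bound when the
   average is [w] and the volume is [E]. *)
pose a := w / E.
have a0 : 0 < a by rewrite divr_gt0.
pose c1 := p * a `^ (p - 1); pose c2 := (p - 1) * a `^ p.
have c20 : 0 <= c2 by rewrite mulr_ge0 ?powR_ge0//; lra.
have c10 : 0 <= c1 by rewrite mulr_ge0 ?powR_ge0// ltW.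
pose L x : \bar R := ((c1%:E * (v x * cutoff r x)%:E) - (c2%:E * (\1_B x)%:E))%E.
have i1 := integrable_average r v Lv.
have i2 : (lebesgue_rV n).-integrable setT (fun x : 'rV[R]_n => (\1_B x)%:E).
  apply/integrableP; split; first exact/measurable_EFinP/measurable_indic.
  under eq_integral do rewrite gee0_abs ?lee_fin//.
  by rewrite integral_indic// setIT lebesgue_box_lty.
have IL : (\int[lebesgue_rV n]_x L x =
    c1%:E * average r v - c2%:E * lebesgue_rV n B)%E.
  rewrite integralB//; [|exact: integrableZl|exact: integrableZl].
  by rewrite !integralZl// integral_indic// setIT.
have lb : ((E * E^-1 `^ p * w `^ p)%:E <= \int[lebesgue_rV n]_x L x)%E.
  rewrite IL -(fineK Bfin) -(fineK (average_fin_num r v Lv)) -!EFinM -EFinB lee_fin.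
  have wv' : w <= fine (average r v).
    by rewrite -lee_fin fineK// average_fin_num.
  have -> : E * E^-1 `^ p * w `^ p = E * a `^ p.
    by rewrite -mulrA -powRM ?invr_ge0 ?(ltW E0) ?(ltW w0)// mulrC [E^-1 * _]mulrC mulrC.
  have aE : a * a `^ (p - 1) = a `^ p by rewrite mulr_powRB1 ?ltW.
  have wE : w = E * a by rewrite /a; field; exact: lt0r_neq0.
  have h1 : c1 * w <= c1 * fine (average r v) by rewrite ler_wpM2l.
  have h2 : c2 * fine (lebesgue_rV n B) <= c2 * E by rewrite ler_wpM2l// lerDl.
  have : c1 * w - c2 * E = E * a `^ p by rewrite /c1 /c2 wE -aE; ring.
  lra.
apply: (le_trans lb); rewrite integralE.
apply: (@le_trans _ _ (\int[lebesgue_rV n]_x L^\+ x)%E).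
  by rewrite -[leRHS]adde0 leeD2l// oppe_le0 integral_ge0.
apply: ge0_le_lower_integral => // x _.
rewrite funeposE ge_max; apply/andP; split; last first.
  by rewrite lee_fin mulr_ge0 ?powR_ge0 ?cutoff_ge0.
rewrite /L -!EFinM -EFinB lee_fin indicE.
have [xB|/cutoff_eq0 c0] := pselect (B x); last first.
  rewrite c0 !mulr0 sub0r oppr_le0 mulr_ge0//.
rewrite mem_set//= mulr1.
have := @powR_ge_tangent _ p a (v x) p1 a0.
rewrite -/c1 -/c2; have := cutoff_ge0 r x; have := cutoff_le1 r x.
set e := cutoff r x => e1 e0 tan.
apply: (@le_trans _ _ ((c1 * v x - c2) * e)); last by rewrite ler_wpM2r.
by rewrite mulrBl lerB ?mulrA// ler_piMr.
Qed.

(** The cut-off is [1] on the support of [v], so that a vanishing average would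
    force [v] to vanish almost everywhere. *)
Lemma average_gt0 {R : realType} {n : nat} (r R0 : R) (v : 'rV[R]_n -> R) :
  L1loc v -> {ae lebesgue_rV n, forall x, 0 <= v x} ->
  ~ {ae lebesgue_rV n, forall x, v x = 0} ->
  esupp v `<=` eball R0 -> R0 <= r -> (0 < average r v)%E.
Proof.
move=> Lv v0 vn0 /esupp_ae v_out R0r.
have iv := integrable_average r v Lv.
have mv := measurable_int _ iv.
have -> : average r v = (\int[lebesgue_rV n]_x `|(v x * cutoff r x)%:E|)%E.
  apply: ae_eq_integral => //; first exact: measurableT_comp.
  by apply: filterS v0 => x vx _; rewrite gee0_abs// lee_fin mulr_ge0 ?cutoff_ge0.
rewrite lt0e integral_ge0// andbT; apply/eqP => /(ae_eq_integral_abs _ measurableT mv).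
move=> vc0; apply: vn0; apply: filterS2 vc0 v_out => x /(_ Logic.I) vc vx.
have [xR|/vx//] := pselect (eball R0 x).
case: vc; rewrite cutoff_eq1 ?mulr1// => i.
exact: le_trans (eball_box _ _ xR i) R0r.
Qed.

(** * Duhamel's formula for the spatial average *)

(** The light cone of the expanding background stays in a fixed ball, so that
    one spatial cut-off serves all times. *)
Lemma A_dS_le {R : realType} (c H t : R) : 0 < c -> 0 < H ->
  A_dS c H t <= c / H.
Proof.
by move=> c0 H0; rewrite /A_dS ler_piMr ?divr_ge0 ?(ltW c0) ?(ltW H0)//.
Qed.

Section duhamel.
Context {R : realType} {n : nat}.
Variables (c H b m2 beta p l d eps R0 t : R) (Gamma : R -> R) (T : \bar R).
Variables (u0 u1 : 'rV[R]_n -> R) (u : R -> 'rV[R]_n -> R).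
Hypotheses (c0 : 0 < c) (H0 : 0 < H) (ldb : d + 2 * l = b)
  (lm2 : l ^+ 2 - b * l + m2 = 0) (t0 : 0 < t) (tT : (t%:E < T)%E).
Hypotheses (Lu0 : L1loc u0) (Lu1 : L1loc u1).
Hypothesis usol : weak_solution c H b m2 beta p Gamma eps u0 u1 R0 T u.
Local Notation leb := (lebesgue_rV n).
Local Notation r := (R0 + c / H + 1).

Lemma weak_solution_L1loc : L1loc (u t).
Proof.
have [ut [[[Lu _] _ _] _ _ _]] := usol.
by apply: Lu; split=> //; exact: ltW.
Qed.

Lemma adjoint_duhamel_test (e s : R) (x : 'rV[R]_n) : 0 < e -> 0 < s <= t ->
  box (R0 + c / H) x ->
  adjoint_operator c H b m2 (duhamel_test l d t e r) s x = 0.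
Proof.
move=> e0 /andP[s0 st] xr; rewrite /adjoint_operator.
have xr' : box (r - 1) x by rewrite addrK.
have ste : s < t + e by lra.
rewrite (dt_duhamel_test _ _ _ _ _ e0)// (dtt_duhamel_test _ _ _ _ _ e0)//.
rewrite (laplacian_duhamel_test _ _ _ _ _ _ _ xr') duhamel_testE ?ltW// mulr0 subr0.
rewrite /propagator'' /propagator' /propagator.
have -> : m2 = b * l - l ^+ 2 by move: lm2; lra.
by rewrite -ldb; ring.
Qed.

(** Since the propagator solves the equation satisfied by spatial averages, the
    space-time integral against the adjoint operator drops out. *)
Lemma duhamel_formula : exists2 e, 0 < e &
  (average r (u t) =
    eps%:E * ((propagator l d t)%:E * average r u1)
    + eps%:E * ((b * propagator l d t + propagator' l d t)%:E * average r u0)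
    + \int[lebesgue_measure]_(s in `[0%R, t])
        ((Gamma s)%:E * (pmass p u s) `^ beta
         * \int[leb]_x (`|u s x| `^ p * duhamel_test l d t e r s x)%:E))%E.
Proof.
have [e e0 teT] : exists2 e, 0 < e & ((t + 2 * e)%:E < T)%E.
  move: tT; case: T => [T'| |//]; last by exists 1; rewrite ?ltry.
  rewrite lte_fin => tT'; exists ((T' - t) / 4); first by rewrite divr_gt0// subr_gt0.
  by rewrite lte_fin; lra.
exists e => //; pose phi := @duhamel_test R n l d t e r.
have Lut := weak_solution_L1loc.
have [ut [_ _ supp ident]] := usol.
have := ident t phi t0 tT (test_function_duhamel l d t e r e0 T t0 teT).
rewrite /weak_identity.
have phit x : phi t x = 0.
  by rewrite /phi duhamel_testE ?lerDl ?ltW// subrr /propagator ramp0 mulr0 mul0r.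
have -> : (\int[leb]_x (ut t x * phi t x)%:E = 0)%E.
  by apply: integral0_eq => x _; rewrite phit mulr0.
have -> : (\int[leb]_x (u t x * phi t x)%:E = 0)%E.
  by apply: integral0_eq => x _; rewrite phit mulr0.
have -> : (\int[leb]_x (u t x * ('D_1 (fun r => phi r x) t))%:E
    = - average r (u t))%E.
  rewrite -[RHS]mul1e muleN -mulNe -EFinN -averageZ//.
  apply: eq_integral => x _; rewrite (dt_duhamel_test _ _ _ _ _ e0) ?ltrDl//.
  by rewrite subrr /propagator' ramp0 !mulr0 subr0 expR0 mulr1.
have -> : (\int[lebesgue_measure]_(s in `[0%R, t])
    \int[leb]_x (u s x * adjoint_operator c H b m2 phi s x)%:E = 0)%E.
  (* The support of [u 0] is not prescribed, but the time [0] is a null set. *)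
  apply: ae0_lower_integral; exists [set 0 : R]; split=> //.
    exact: lebesgue_measure_set1.
  move=> s /= /not_implyP[]; rewrite in_itv/= => /andP[s0 st] us.
  apply/eqP; apply: contrapT => /negP sn0.
  have {sn0} s0' : 0 < s by rewrite lt_neqAle eq_sym s0 andbT.
  apply: us; apply: ae0_lower_integral.
  have sT : (s%:E < T)%E by apply: le_lt_trans tT; rewrite lee_fin.
  have := esupp_ae _ _ (supp s s0' sT).
  apply: filterS => x ux _.
  have [xs|/ux ->] := pselect (eball (R0 + A_dS c H s) x); last by rewrite mul0r.
  rewrite adjoint_duhamel_test ?mulr0 ?s0' ?st// => i.
  by apply: (le_trans (eball_box _ _ xs i)); rewrite lerD2l A_dS_le.
have phi0 x : phi 0 x = propagator l d t * cutoff r x.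
  by rewrite /phi duhamel_testE ?subr0// addr_ge0 ?ltW.
have -> : (\int[leb]_x (u1 x * phi 0 x)%:E = (propagator l d t)%:E * average r u1)%E.
  by rewrite -averageZ//; apply: eq_integral => x _; rewrite phi0.
have -> : (\int[leb]_x (u0 x * (b * phi 0 x - 'D_1 (fun r => phi r x) 0%R))%:E =
    (b * propagator l d t + propagator' l d t)%:E * average r u0)%E.
  rewrite -averageZ//; apply: eq_integral => x _.
  rewrite phi0 (dt_duhamel_test _ _ _ _ _ e0) ?addr_gt0// subr0.
  by congr (_%:E); ring.
by rewrite mule0 adde0 adde0 add0e oppeK.
Qed.

End duhamel.

(** * The iteration *)

(** Doubling the lower bound [m] on [Z] costs a multiplicative step [expR (2 * x)]
    in [1 + t], where [x ^+ 2 / (1 + x)] is of order [m `^ (1 - q)]. These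
    costs decay geometrically, so that infinitely many doublings fit below a time
    whose logarithm is of order [eps `^ (1 - q)]. *)
Lemma lifespan_bound {R : realType} (q a k : R) : 1 < q -> 0 < a -> 0 < k ->
  exists2 K, 0 < K & forall (eps : R) (T : \bar R) (Z : R -> R),
    0 < eps <= 1 ->
    (forall t, 0 < t -> (t%:E < T)%E -> a * eps <= Z t) ->
    (forall t s0 s1 m, 0 <= s0 -> s0 < s1 -> s1 <= t -> (t%:E < T)%E -> 0 < m ->
      (forall s, s0 < s -> s <= s1 -> m <= Z s) ->
      k * m `^ q * ((t - s1) / (1 + t)) * ln ((1 + s1) / (1 + s0)) <= Z t) ->
    (T <= (expR (K * eps `^ (1 - q)))%:E)%E.
Proof.
move=> q1 a0 k0.
(* The cost [x] of a doubling shrinks by the factor [r] each time: for small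
   costs, [x ^+ 2] has to be of order [m `^ (1 - q)]. *)
pose r : R := 2 `^ ((1 - q) / 2).
have r0 : 0 < r by exact: powR_gt0.
have r1 : r < 1.
  have := @ltr_expR R ((1 - q) / 2 * ln 2) 0; rewrite expR0.
  rewrite /r /powR gt_eqF// => ->.
  have l2 : 0 < ln 2 :> R by rewrite ln_gt0// ltr1n.
  nra.
have r2 : r * r = 2 `^ (1 - q) by rewrite /r -powRD; [congr powR; field|apply/implyP].
pose D := 1 + 4 / k * a `^ (1 - q).
have D0 : 0 < D by rewrite ltr_pwDl// mulr_ge0 ?powR_ge0// divr_ge0// ltW.
exists (2 * D / (1 - r)); first by rewrite divr_gt0 ?mulr_gt0// subr_gt0.
move=> eps T Z /andP[e0 e1] Z0 Zrec; rewrite leNgt; apply/negP => tT.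
pose Y := 2 / k * (a * eps) `^ (1 - q).
have Y0 : 0 < Y by rewrite mulr_gt0 ?divr_gt0// powR_gt0// mulr_gt0.
(* [Y] is the value of [x ^+ 2 / (1 + x)] needed for the first doubling, and
   [x = 1 + 2 * Y] reaches it. *)
pose A := 1 + 2 * Y.
have AD : A <= D * eps `^ (1 - q).
  have E1 : 1 <= eps `^ (1 - q).
    by have := @ger_powR _ eps _ (1 - q) 0; rewrite powRr0; apply; rewrite ?e0//; lra.
  have YE : 2 * Y = 4 / k * a `^ (1 - q) * eps `^ (1 - q).
    by rewrite /Y powRM ?(ltW a0) ?(ltW e0)//; field; exact: lt0r_neq0.
  by rewrite /A YE /D [leRHS]mulrDl mul1r lerD2r.
(* The partial sum of the steps [2 * (A * r ^+ i)]. *)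
pose S j := 2 * A * (1 - r ^+ j) / (1 - r).
have SS j : S j.+1 = S j + 2 * (A * r ^+ j).
  by rewrite /S exprS; field; rewrite subr_eq0 gt_eqF.
have rj0 j : 0 < r ^+ j by exact: exprn_gt0.
have rj1 j : r ^+ j <= 1 by rewrite exprn_ile1// ltW.
have A0 : 0 < A by rewrite /A; lra.
have S0 j : 0 <= S j.
  by rewrite /S divr_ge0 ?mulr_ge0 ?subr_ge0// ltW.
have bound j t : expR (S j) < 1 + t -> (t%:E < T)%E -> 2 ^+ j * (a * eps) <= Z t.
  elim: j t => [|j IHj] t.
    rewrite /S expr0 subrr mulr0 mul0r expR0 mul1r => t0; apply: Z0; lra.
  pose x := A * r ^+ j; have x0 : 0 < x by exact: mulr_gt0.
  rewrite SS -/x => St tT'.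
  set m := 2 ^+ j * (a * eps).
  have m0 : 0 < m by rewrite !mulr_gt0// exprn_gt0.
  have Sx : expR (S j) < expR (S j + x) by rewrite ltr_expR; lra.
  have Sx' : expR (S j + x) < expR (S j + 2 * x) by rewrite ltr_expR; lra.
  have S1 : 1 <= expR (S j) by rewrite -[leLHS]expR0 ler_expR.
  have := Zrec t (expR (S j) - 1) (expR (S j + x) - 1) m.
  have -> : 1 + (expR (S j + x) - 1) = expR (S j + x) by ring.
  have -> : 1 + (expR (S j) - 1) = expR (S j) by ring.
  rewrite -expRB addrAC subrr add0r expRK.
  move=> /(_ _ _ _ tT' m0) Zt.
  have {Zt} : k * m `^ q * ((t - (expR (S j + x) - 1)) / (1 + t)) * x <= Z t.
    apply: Zt; [lra|lra|lra|move=> s s0 s1; apply: IHj; first lra].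
    by apply: le_lt_trans tT'; rewrite lee_fin; lra.
  apply: le_trans.
  have t0 : 0 < 1 + t by lra.
  (* Half of the step separates [t] from the interval of integration, the other
     half is the logarithmic length of that interval. *)
  have gap : x / (1 + x) <= (t - (expR (S j + x) - 1)) / (1 + t).
    rewrite ler_pdivrMr ?addr_gt0// mulrAC ler_pdivlMr//.
    have : expR (S j + x) * (1 + x) <= 1 + t.
      apply/ltW/le_lt_trans/St; have -> : S j + 2 * x = (S j + x) + x by ring.
      by rewrite [leRHS]expRD ler_pM2l ?expR_gt0// expR_ge1Dx.
    nra.
  have mq : m `^ q = m * m `^ (q - 1) by rewrite mulr_powRB1 ?(ltW m0)//; lra.
  have key : 2 * (1 + x) <= k * m `^ (q - 1) * x ^+ 2.
    have mr : m `^ (q - 1) * (r ^+ j) ^+ 2 = (a * eps) `^ (q - 1).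
      rewrite -exprM mulnC exprM expr2 r2 /m.
      rewrite powRM; [|exact: exprn_ge0|exact/ltW/mulr_gt0].
      have one : (2 ^+ j) `^ (q - 1) * (2 `^ (1 - q)) ^+ j = 1 :> R.
        rewrite -!powR_mulrn ?powR_ge0// -!powRrM (mulrC (1 - q)) -powRD; last first.
          by apply/implyP => _; rewrite pnatr_eq0.
        by rewrite -mulrDr (_ : _ + _ = 0) ?mulr0 ?powRr0//; ring.
      by rewrite mulrAC one mul1r.
    have Ya : k * (a * eps) `^ (q - 1) * Y = 2.
      have one : (a * eps) `^ (q - 1) * (a * eps) `^ (1 - q) = 1.
        rewrite -powRD; last by apply/implyP => _; rewrite mulf_neq0// gt_eqF.
        by rewrite (_ : _ + _ = 0) ?powRr0//; ring.
      have -> : k * (a * eps) `^ (q - 1) * Y =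
          2 * ((a * eps) `^ (q - 1) * (a * eps) `^ (1 - q)).
        by rewrite /Y; field; rewrite gt_eqF.
      by rewrite one mulr1.
    have -> : k * m `^ (q - 1) * x ^+ 2 = k * (a * eps) `^ (q - 1) * A ^+ 2.
      by rewrite -mr /x; ring.
    have xA : x <= A by rewrite /x ler_piMr// ltW.
    have : 0 < k * (a * eps) `^ (q - 1) by rewrite mulr_gt0// powR_gt0// mulr_gt0.
    move: Ya xA; rewrite /A; set V := k * _ => VY xA V0.
    nra.
  apply: (@le_trans _ _ (k * m `^ q * (x / (1 + x)) * x)); last first.
    by rewrite ler_pM2r// ler_pM2l// mulr_gt0// powR_gt0.
  rewrite mq; have -> : k * (m * m `^ (q - 1)) * (x / (1 + x)) * x =
      m * (k * m `^ (q - 1) * x ^+ 2) / (1 + x) by ring.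
  rewrite ler_pdivlMr ?addr_gt0//.
  have -> : 2 ^+ j.+1 * (a * eps) * (1 + x) = m * (2 * (1 + x)).
    by rewrite /m exprS; ring.
  by rewrite ler_pM2l.
pose t := expR (2 * D / (1 - r) * eps `^ (1 - q)).
have {bound} bd j : 2 ^+ j * (a * eps) <= Z t.
  apply: bound => //; rewrite (@le_lt_trans _ _ t)//; last by rewrite ltrDr.
  rewrite ler_expR /S.
  have -> : 2 * D / (1 - r) * eps `^ (1 - q) =
    2 * (D * eps `^ (1 - q)) / (1 - r) by ring.
  rewrite ler_pM2r ?invr_gt0 ?subr_gt0// -mulrA ler_pM2l//.
  by apply: le_trans AD; rewrite ler_piMr ?(ltW A0)// gerBl ltW.
have ae0 : 0 < a * eps by exact: mulr_gt0.
have := bd (Num.truncn (Z t / (a * eps))).+1; rewrite leNgt => /negP; apply.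
rewrite -ltr_pdivrMr//; apply: (lt_trans (truncnS_gt _)).
by rewrite -natrX ltr_nat ltn_expl.
Qed.

(** * The feedback inequality *)

Lemma continuous_inv1D {R : realType} (s0 s1 : R) : 0 <= s0 ->
  {within `[s0, s1], continuous (fun s : R => (1 + s)^-1)}.
Proof.
move=> s00; apply: continuous_in_subspaceT => s.
rewrite inE/= in_itv/= => /andP[ss _].
apply: cvgV; first by rewrite gt_eqF//; lra.
by apply: cvgD; [exact: cvg_cst|exact: cvg_id].
Qed.

Lemma measurable_inv1D {R : realType} (s0 s1 : R) : 0 <= s0 ->
  measurable_fun `]s0, s1] (fun s : R => ((1 + s)^-1)%:E).
Proof.
move=> s00; apply/measurable_EFinP; have cwi := continuous_inv1D s0 s1 s00.
apply: measurable_funS (subspace_continuous_measurable_fun _ cwi) => //.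
exact: subset_itv_oc_cc.
Qed.

Lemma integral_inv1D {R : realType} (s0 s1 : R) : 0 <= s0 -> s0 < s1 ->
  (\int[lebesgue_measure]_(s in `]s0, s1]) ((1 + s)^-1)%:E =
   (ln ((1 + s1) / (1 + s0)))%:E)%E.
Proof.
move=> s00 s01.
have dln (s : R) : 0 < 1 + s -> is_derive s 1 (fun s : R => ln (1 + s)) (1 + s)^-1.
  move=> s1s; have ds : is_derive s 1 (fun s : R => 1 + s) 1.
    by rewrite -[X in is_derive _ _ _ X]add0r; apply: is_deriveD.
  have dl := is_derive1_ln s1s.
  have := @is_derive1_comp _ (@ln R) (fun s : R => 1 + s) s _ _ dl ds.
  by rewrite mulr1.
have cln (s : R) : 0 < 1 + s -> {for s, continuous (fun s : R => ln (1 + s))}.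
  move=> /dln[ds _]; apply: differentiable_continuous.
  exact/derivable1_diffP.
have cwi := continuous_inv1D s0 s1 s00.
rewrite integral_itv_obnd_cbnd; last exact: measurable_inv1D.
rewrite (continuous_FTC2 s01 cwi (F := fun s : R => ln (1 + s))).
- by rewrite -EFinB ln_div// posrE; lra.
- split=> [s||].
  + by rewrite in_itv/= => /andP[ss _]; have [] : is_derive s 1
      (fun s : R => ln (1 + s)) (1 + s)^-1 by apply: dln; lra.
  + by apply: cvg_at_right_filter; apply: cln; lra.
  + by apply: cvg_at_left_filter; apply: cln; lra.
- move=> s; rewrite in_itv/= => /andP[ss _]; rewrite derive1E.
  by have [] : is_derive s 1 (fun s : R => ln (1 + s)) (1 + s)^-1 by apply: dln; lra.
Qed.

(** The size of the solutions of the homogeneous equation, relative to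
    [expR (- l * t)]: a double root produces the extra factor [1 + t]. *)
Definition weight {R : realType} (d t : R) : R := if d == 0 then 1 + t else 1.

Lemma weight_gt0 {R : realType} (d t : R) : 0 <= t -> 0 < weight d t.
Proof. by move=> t0; rewrite /weight; case: ifP => _ //; lra. Qed.

Lemma expRN_le {R : realType} (x : R) : 0 <= x -> expR (- x) * (1 + x) <= 1.
Proof.
move=> x0; rewrite expRN mulrC ler_pdivrMr ?expR_gt0// mul1r.
exact: expR_ge1Dx.
Qed.

Lemma ramp_ge0 {R : realType} (d x : R) : 0 <= d -> 0 <= x -> 0 <= ramp d x.
Proof.
move=> d0 x0; rewrite /ramp; case: ifP => // _.
by rewrite divr_ge0// subr_ge0 -[leRHS]expR0 ler_expR mulNr oppr_le0 mulr_ge0.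
Qed.

(** In the variable [ln (1 + t)] the lower bound [(t - s) / (1 + t)] depends on
    the difference of the two times only, and it serves for simple roots and for
    a double root alike. *)
Lemma weight_le_ramp {R : realType} (d s t : R) : 0 <= d -> 0 <= s -> s <= t ->
  weight d t * ((t - s) / (1 + t)) <= (1 + d) * ramp d (t - s).
Proof.
move=> d0 s0 st; rewrite /weight /ramp; case: ifPn => [/eqP ->|dN0].
  by rewrite addr0 mul1r mulrCA divff ?mulr1//; lra.
have dp : 0 < d by rewrite lt_neqAle eq_sym dN0.
set x := t - s; have x0 : 0 <= x by rewrite /x; lra.
have xt : x <= t by rewrite /x; lra.
have := expRN_le (d * x) (mulr_ge0 d0 x0); rewrite mulNr; set E := expR _ => EE.
have dx : 0 <= d * x by exact: mulr_ge0.
have h : d * x / (1 + d * x) <= 1 - E.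
  by rewrite ler_pdivrMr; nra.
rewrite mul1r; apply: (@le_trans _ _ ((1 + d) * (x / (1 + d * x)))).
  rewrite mulrA ler_pdivrMr; last lra.
  rewrite mulrAC ler_pdivlMr; last lra.
  have : 0 <= d * (t - x) by apply: mulr_ge0; lra.
  nra.
rewrite ler_wpM2l//; first lra.
by rewrite ler_pdivlMr// mulrAC [x * d]mulrC.
Qed.

(** Without damping ([l = 0]) and with a double root the datum [u0] alone yields
    a bounded average; the growth [1 + t] then comes from [u1]. *)
Lemma weight_le_data {R : realType} (d l I0 I1 : R) : 0 <= d -> 0 <= l ->
  0 < I0 -> 0 < I1 -> exists2 a, 0 < a & forall t, 0 <= t ->
  a * weight d t <=
    ramp d t * I1 + ((d + l) * ramp d t + expR (- d * t)) * I0.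
Proof.
move=> d0 l0 I00 I10; exists (Num.min I0 I1); first by rewrite lt_min I00.
have mI0 : Num.min I0 I1 <= I0 by rewrite ge_min lexx.
have mI1 : Num.min I0 I1 <= I1 by rewrite ge_min lexx orbT.
move=> t t0; have g0 := ramp_ge0 d t d0 t0.
have lg : 0 <= l * ramp d t * I0 by rewrite !mulr_ge0// ltW.
have := weight_gt0 d t t0.
move: g0 lg; rewrite /ramp /weight; case: ifPn => [/eqP ->|dN0] g0 lg w0.
  rewrite oppr0 mul0r expR0 add0r.
  have : Num.min I0 I1 * t <= I1 * t by rewrite ler_wpM2r.
  nra.
set E := expR _; set g := (1 - E) / d.
have dg : d * g = 1 - E by rewrite /g; field.
have : 0 <= g * I1 by rewrite mulr_ge0// ltW.
have -> : (d + l) * g + E = 1 + l * g by rewrite mulrDl dg; ring.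
rewrite mulr1 mulrDl mul1r; move: lg; rewrite -/E -/g; lra.
Qed.

(** The exponentials of the propagator, of [Gamma_crit] and of the a priori
    bound cancel: this is what makes the exponent of [Gamma_crit] critical. *)
Lemma critical_balance {R : realType} (mu k q l d kappa m s t : R) :
  0 <= s -> 0 < m ->
  kappa = (if d == 0 then - 1 - q else - 1) ->
  mu * expR (l * (q - 1) * s) * (1 + s) `^ kappa
    * (k * (m * weight d s * expR (- l * s)) `^ q)
    * propagator l d (t - s) =
  mu * k * m `^ q * (1 + s)^-1 * ramp d (t - s) * expR (- l * t).
Proof.
move=> s0 m0 ->; have w0 := weight_gt0 d s s0.
have s1 : 0 < 1 + s by lra.
rewrite !powRM ?mulr_ge0 ?expR_ge0 ?(ltW m0) ?(ltW w0)//.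
have W : (1 + s) `^ (if d == 0 then -1 - q else -1) * weight d s `^ q = (1 + s)^-1.
  rewrite /weight; case: ifP => _; last by rewrite powR1 mulr1 powR_inv1// ltW.
  rewrite -powRD; last by apply/implyP => _; rewrite gt_eqF.
  by rewrite addrNK powR_inv1// ltW.
have E : expR (l * (q - 1) * s) * expR (- l * s) `^ q * expR (- l * (t - s)) =
    expR (- l * t).
  by rewrite -expRM -!expRD; congr expR; ring.
rewrite /propagator -E -W; ring.
Qed.

Section feedback.
Context {R : realType} {n : nat}.
Variables (c H b m2 beta p mu R0 : R) (u0 u1 : 'rV[R]_n -> R).
Hypotheses (hc : 0 < c) (hH : 0 < H) (hb : 0 <= b) (hm2 : 0 <= m2)
  (hbm : 4 * m2 <= b ^+ 2) (hbeta : 0 <= beta) (hp : 1 < p) (hmu : 0 < mu)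
  (hR0 : 0 < R0).
Hypotheses (Lu0 : L1loc u0) (Lu1 : L1loc u1)
  (au0 : (0 < average (R0 + c / H + 1) u0)%E)
  (au1 : (0 < average (R0 + c / H + 1) u1)%E).
Local Notation leb := (lebesgue_rV n).
Local Notation r := (R0 + c / H + 1).
Local Notation q := ((beta + 1) * p).
Local Notation d := (Num.sqrt (b ^+ 2 - 4 * m2)).
Local Notation l := (2^-1 * (b - d)).
Local Notation Gamma := (Gamma_crit b m2 beta p mu).
Local Notation sol eps := (weak_solution c H b m2 beta p Gamma eps u0 u1 R0).

(** The spatial average of the solution, normalised by the decay of the
    homogeneous equation. *)
Definition normalised_average (u : R -> 'rV[R]_n -> R) (t : R) : R :=
  fine (average r (u t)) * expR (l * t) / weight d t.
Local Notation Z := normalised_average.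

Let d0 : 0 <= d. Proof. exact: sqrtr_ge0. Qed.

Let d2 : d * d = b ^+ 2 - 4 * m2.
Proof. by rewrite -expr2 sqr_sqrtr// subr_ge0. Qed.

Let l0 : 0 <= l.
Proof.
have : d <= b by rewrite -[leRHS](ger0_norm hb) -sqrtr_sqr ler_wsqrtr// gerBl mulr_ge0.
lra.
Qed.

Let ldb : d + 2 * l = b.
Proof. by field. Qed.

Let lm2 : l ^+ 2 - b * l + m2 = 0.
Proof.
have -> : l ^+ 2 - b * l + m2 = (d * d - (b ^+ 2 - 4 * m2)) / 4 by field.
by rewrite d2 subrr mul0r.
Qed.

Let r0 : 0 <= r.
Proof. by rewrite addr_ge0// addr_ge0 ?divr_ge0// ltW. Qed.

Let GammaE t : Gamma t = mu * expR (l * (q - 1) * t) *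
  (1 + t) `^ (if d == 0 then - 1 - q else - 1).
Proof.
rewrite /Gamma_crit /r_crit /kappa_crit; congr (_ * _ `^ _).
by rewrite sqrtr_eq0 subr_le0 leNgt; case: ifP.
Qed.

Let Gamma_ge0 t : 0 <= Gamma t.
Proof. by rewrite GammaE !mulr_ge0 ?expR_ge0 ?powR_ge0// ltW. Qed.

Let fine_average_gt0 (v : 'rV[R]_n -> R) : L1loc v -> (0 < average r v)%E ->
  0 < fine (average r v).
Proof.
move=> Lv v0; apply: fine_gt0; rewrite v0/= ltey_eq.
by rewrite average_fin_num.
Qed.

Let propagator_ge0 t : 0 <= t -> 0 <= propagator l d t.
Proof. by move=> t0; rewrite mulr_ge0 ?expR_ge0// ramp_ge0. Qed.

Let test_ge0 e t s (x : 'rV[R]_n) : s <= t ->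
  0 <= duhamel_test l d t e r s x.
Proof.
move=> st; rewrite /duhamel_test mulr_ge0 ?cutoff_ge0// mulr_ge0 ?step_ge0//.
by rewrite propagator_ge0// subr_ge0.
Qed.

Let source e t u (s : R) : \bar R :=
  ((Gamma s)%:E * (pmass p u s) `^ beta
    * \int[leb]_x (`|u s x| `^ p * duhamel_test l d t e r s x)%:E)%E.

Let source_ge0 e t u s : s <= t -> (0 <= source e t u s)%E.
Proof.
move=> st; rewrite !mule_ge0 ?poweR_ge0 ?lee_fin//.
by apply: integral_ge0 => x _; rewrite lee_fin mulr_ge0 ?powR_ge0 ?test_ge0.
Qed.

(** Duhamel's formula with the data and the source separated; both parts are
    nonnegative. *)
Let average_split eps t T u : 0 <= eps -> 0 < t -> (t%:E < T)%E ->
  sol eps T u -> exists2 e, 0 < e &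
  (average r (u t) =
    (eps * expR (- l * t) * (ramp d t * fine (average r u1)
     + ((d + l) * ramp d t + expR (- d * t)) * fine (average r u0)))%:E
    + \int[lebesgue_measure]_(s in `[0%R, t]) source e t u s)%E.
Proof.
move=> e0 t0 tT usol.
have [e ee ->] := @duhamel_formula _ _ _ _ _ _ _ _ _ _ _ _ _ _ _ _ _ _
  hc hH ldb lm2 t0 tT Lu0 Lu1 usol.
exists e => //; congr (_ + _)%E.
rewrite -(fineK (average_fin_num r u0 Lu0)) -(fineK (average_fin_num r u1 Lu1)) /=.
rewrite -!EFinM -EFinD; congr (_%:E).
rewrite /propagator' /propagator.
set I0 := fine _; set I1 := fine _.
by field.
Qed.

Lemma data_lower_bound : exists2 a, 0 < a & forall eps T u, 0 <= eps ->
  sol eps T u -> forall t, 0 < t -> (t%:E < T)%E -> a * eps <= Z u t.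
Proof.
have [a a0 aw] := weight_le_data d l _ _ d0 l0
  (fine_average_gt0 _ Lu0 au0) (fine_average_gt0 _ Lu1 au1).
exists a => // eps T u eps0 usol t t0 tT.
have [e e0 U] := average_split _ _ _ _ eps0 t0 tT usol.
have Lut := weak_solution_L1loc _ _ _ _ _ _ _ _ _ _ _ _ _ _ t0 tT usol.
rewrite /normalised_average ler_pdivlMr ?weight_gt0 ?(ltW t0)//.
set D := (X in (_ * X)%:E) in U.
have {}U : eps * expR (- l * t) * D <= fine (average r (u t)).
  rewrite -lee_fin fineK ?average_fin_num// U leeDl// integral_ge0// => s.
  by rewrite /= in_itv/= => /andP[_ st]; exact: source_ge0.
have E : expR (- l * t) * expR (l * t) = 1 by rewrite -expRD mulNr addNr expR0.
apply: (@le_trans _ _ (eps * expR (- l * t) * D * expR (l * t))); last first.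
  by rewrite ler_wpM2r ?expR_ge0.
have -> : eps * expR (- l * t) * D * expR (l * t) =
  eps * D * (expR (- l * t) * expR (l * t)) by ring.
rewrite E mulr1 -mulrA mulrCA ler_wpM2l//; exact: aw (ltW t0).
Qed.

(** Jensen's inequality is used for both factors of the nonlinearity, the
    power [beta] of the total mass and the integral against the test function. *)
Lemma source_lower_bound : exists2 k, 0 < k & forall eps T u, sol eps T u ->
  forall e t s m, 0 < e -> 0 < s -> s <= t -> (t%:E < T)%E -> 0 < m ->
  m <= Z u s ->
  ((k * m `^ q * (1 + s)^-1 * ramp d (t - s) * expR (- l * t))%:E
    <= source e t u s)%E.
Proof.
have [k k0 jensen] := @jensen_cutoff R n r p r0 hp.
exists (mu * k `^ (beta + 1)); first by rewrite mulr_gt0// powR_gt0.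
move=> eps T u usol e t s m e0 s0 st tT m0 mZ.
have sT : (s%:E < T)%E by apply: le_lt_trans tT; rewrite lee_fin.
have Lus := weak_solution_L1loc _ _ _ _ _ _ _ _ _ _ _ _ _ _ s0 sT usol.
pose w := m * weight d s * expR (- l * s).
have ws0 := weight_gt0 d s (ltW s0).
have w0 : 0 < w by rewrite !mulr_gt0// expR_gt0.
have wU : (w%:E <= average r (u s))%E.
  rewrite -(fineK (average_fin_num r (u s) Lus)) lee_fin.
  move: mZ; rewrite /normalised_average ler_pdivlMr// => mZ.
  rewrite /w mulNr expRN -[_ / _]/(_ * _^-1) ler_pdivrMr ?expR_gt0//.
pose J := (\int[leb]_x (`|u s x| `^ p * cutoff r x)%:E)%E.
have kJ : ((k * w `^ p)%:E <= J)%E by exact: jensen.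
have kw0 : 0 <= k * w `^ p by rewrite mulr_ge0 ?powR_ge0// ltW.
have kM : ((k * w `^ p)%:E <= pmass p u s)%E.
  apply: (le_trans kJ); apply: ge0_le_lower_integral => x _.
    by rewrite lee_fin mulr_ge0 ?powR_ge0 ?cutoff_ge0.
  by rewrite lee_fin ler_piMr ?powR_ge0 ?cutoff_le1.
have mus : measurable_fun [set: 'rV[R]_n] (fun x => `|u s x| `^ p * cutoff r x).
  apply: measurable_funM; last exact: measurable_cutoff.
  apply: (@measurableT_comp _ _ _ _ _ _ (fun y : R => y `^ p)).
    exact: measurable_powR.
  by apply: measurableT_comp => //; case: Lus.
have ts0 : 0 <= t - s by rewrite subr_ge0.
have -> : source e t u s =
    ((Gamma s)%:E * (pmass p u s) `^ beta * ((propagator l d (t - s))%:E * J))%E.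
  rewrite /source; congr (_ * _)%E.
  rewrite /J -ge0_integralZl//; last 3 first.
  - exact/measurable_EFinP.
  - by move=> x _; rewrite lee_fin mulr_ge0 ?powR_ge0 ?cutoff_ge0.
  - by rewrite lee_fin propagator_ge0.
  apply: eq_integral => x _; rewrite duhamel_testE//; last lra.
  by rewrite -EFinM mulrCA.
have Mb : (((k * w `^ p) `^ beta)%:E <= (pmass p u s) `^ beta)%E.
  rewrite -poweR_EFin; apply: gt0_ler_poweR => //; rewrite in_itv/= leey andbT.
    by rewrite lee_fin.
  by apply: integral_ge0 => x _; rewrite lee_fin powR_ge0.
apply: (@le_trans _ _ ((Gamma s)%:E * ((k * w `^ p) `^ beta)%:E *
    ((propagator l d (t - s))%:E * (k * w `^ p)%:E))%E); last first.
  apply: lee_pmul.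
  - by rewrite -EFinM lee_fin mulr_ge0 ?powR_ge0.
  - by rewrite -EFinM lee_fin mulr_ge0 ?propagator_ge0.
  - by apply: lee_wpmul2l => //; rewrite lee_fin.
  - by apply: lee_wpmul2l => //; rewrite lee_fin propagator_ge0.
rewrite -!EFinM lee_fin le_eqVlt; apply/orP; left; apply/eqP.
rewrite -(critical_balance mu _ q l d _ m s t (ltW s0) m0 erefl) -GammaE -/w.
have kwq : (k * w `^ p) `^ beta * (k * w `^ p) = k `^ (beta + 1) * w `^ q.
  have kwp : 0 < k * w `^ p by rewrite mulr_gt0// powR_gt0.
  rewrite -[X in _ * X = _](powRr1 kw0) -powRD; last first.
    by apply/implyP => _; rewrite gt_eqF.
  by rewrite powRM ?powR_ge0 ?(ltW k0)// -powRrM (mulrC p).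
by rewrite -kwq; ring.
Qed.

(** A bound [m] on a time interval feeds back into all later times, through the
    part of the source living on that interval. *)
Lemma feedback : exists2 k, 0 < k & forall eps T u, 0 <= eps -> sol eps T u ->
  forall t s0 s1 m, 0 <= s0 -> s0 < s1 -> s1 <= t -> (t%:E < T)%E -> 0 < m ->
  (forall s, s0 < s -> s <= s1 -> m <= Z u s) ->
  k * m `^ q * ((t - s1) / (1 + t)) * ln ((1 + s1) / (1 + s0)) <= Z u t.
Proof.
have [k k0 src] := source_lower_bound.
have d1 : 0 < 1 + d by rewrite ltr_pwDl.
exists (k / (1 + d)); first by rewrite divr_gt0.
move=> eps T u eps0 usol t s0 s1 m s00 s01 s1t tT m0 mZ.
have t0 : 0 < t by rewrite (lt_le_trans _ s1t)// (le_lt_trans s00).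
have [e e0 U] := average_split _ _ _ _ eps0 t0 tT usol.
have Lut := weak_solution_L1loc _ _ _ _ _ _ _ _ _ _ _ _ _ _ t0 tT usol.
have wt0 := weight_gt0 d t (ltW t0).
pose C := k / (1 + d) * m `^ q * ((t - s1) / (1 + t)) * weight d t * expR (- l * t).
have C0 : 0 <= C.
  rewrite /C !mulr_ge0 ?powR_ge0 ?expR_ge0 ?(ltW wt0) ?(ltW k0) ?invr_ge0 ?(ltW d1)//.
    by rewrite subr_ge0.
  by lra.
have key : C * ln ((1 + s1) / (1 + s0)) <= fine (average r (u t)).
  rewrite -lee_fin fineK ?average_fin_num// U.
  apply: (@le_trans _ _ (\int[lebesgue_measure]_(s in `[0%R, t]) source e t u s)%E);
    last first.
    rewrite leeDr// lee_fin !mulr_ge0 ?expR_ge0// addr_ge0// mulr_ge0 ?ramp_ge0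
      ?(ltW t0)//.
    - exact/ltW/fine_average_gt0.
    - by rewrite addr_ge0 ?expR_ge0// mulr_ge0 ?addr_ge0 ?ramp_ge0 ?(ltW t0).
    - exact/ltW/fine_average_gt0.
  rewrite EFinM -integral_inv1D// -ge0_integralZl//; last 2 first.
  - exact: measurable_inv1D.
  - by move=> s; rewrite /= in_itv/= => /andP[ss _]; rewrite lee_fin invr_ge0; lra.
  have sub : `]s0, s1]%classic `<=` `[0, t]%classic.
    by move=> s; rewrite /= !in_itv/= => /andP[? ?]; apply/andP; split; lra.
  rewrite -(setIidr sub) integral_mkcondr.
  apply: ge0_le_lower_integral => s.
    move=> _; rewrite patchE; case: ifPn => //.
    rewrite inE/= in_itv/= => /andP[ss _].
    by rewrite -EFinM lee_fin mulr_ge0// invr_ge0; lra.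
  rewrite /= in_itv/= patchE => /andP[s_ge0 st].
  case: ifPn => [|_]; last exact: source_ge0.
  rewrite inE/= in_itv/= => /andP[s0s ss1].
  have sp : 0 < s by lra.
  apply: le_trans (src _ _ _ usol e t s m e0 sp st tT m0 (mZ s s0s ss1)).
  rewrite -EFinM lee_fin.
  have wr := weight_le_ramp d s t d0 s_ge0 st.
  have h1 : weight d t * ((t - s1) / (1 + t)) <= (1 + d) * ramp d (t - s).
    apply: le_trans wr; rewrite ler_pM2l// ler_pM2r ?invr_gt0; lra.
  have h2 : weight d t * ((t - s1) / (1 + t)) / (1 + d) <= ramp d (t - s).
    by rewrite ler_pdivrMr// [leRHS]mulrC.
  have -> : C / (1 + s) = k * m `^ q * (1 + s)^-1 * expR (- l * t) *
      (weight d t * ((t - s1) / (1 + t)) / (1 + d)) by rewrite /C; ring.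
  have -> : k * m `^ q / (1 + s) * ramp d (t - s) * expR (- l * t) =
    k * m `^ q * (1 + s)^-1 * expR (- l * t) * ramp d (t - s) by ring.
  rewrite ler_wpM2l// !mulr_ge0 ?expR_ge0 ?powR_ge0 ?invr_ge0 ?(ltW k0)//; lra.
rewrite /normalised_average ler_pdivlMr//.
have E : expR (- l * t) * expR (l * t) = 1 by rewrite -expRD mulNr addNr expR0.
apply: le_trans (ler_wpM2r (expR_ge0 (l * t)) key).
rewrite le_eqVlt; apply/orP; left; apply/eqP.
set L := ln _; have -> : C * L * expR (l * t) = k / (1 + d) * m `^ q *
    ((t - s1) / (1 + t)) * weight d t * L * (expR (- l * t) * expR (l * t)).
  by rewrite /C; ring.
by rewrite E mulr1 mulrAC.
Qed.

End feedback.

Theorem theorem1p4 (R : realType) (n : nat) (hn : (1 <= n)%N)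
    (c H b m2 beta p mu R0 : R)
    (hc : 0 < c) (hH : 0 < H) (hb : 0 <= b) (hm2 : 0 <= m2)
    (hbm : 4 * m2 <= b ^+ 2)
    (hbeta : 0 <= beta) (hp : 1 < p) (hmu : 0 < mu) (hR0 : 0 < R0)
    (u0 u1 : 'rV[R]_n -> R)
    (u0_L1loc : L1loc u0) (u1_L1loc : L1loc u1)
    (u0_ge0 : {ae lebesgue_rV n, forall x, 0 <= u0 x})
    (u1_ge0 : {ae lebesgue_rV n, forall x, 0 <= u1 x})
    (u0_nontrivial : ~ {ae lebesgue_rV n, forall x, u0 x = 0})
    (u1_nontrivial : ~ {ae lebesgue_rV n, forall x, u1 x = 0})
    (u0_supp : esupp u0 `<=` eball R0) (u1_supp : esupp u1 `<=` eball R0) :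
  exists eps0 C K : R, [/\ 0 < eps0, 0 < C, 0 < K &
    forall eps : R, 0 < eps <= eps0 ->
    forall (T : \bar R) (u : R -> 'rV[R]_n -> R),
      weak_solution_with_lifespan c H b m2 beta p
        (Gamma_crit b m2 beta p mu) eps u0 u1 R0 T u ->
      (T < +oo)%E /\
      (T <= (C * expR (K * eps `^ (- ((beta + 1) * p - 1))))%:E)%E].
Proof.
have Rr : R0 <= R0 + c / H + 1.
  have : 0 < c / H by rewrite divr_gt0.
  lra.
have au0 := average_gt0 _ _ _ u0_L1loc u0_ge0 u0_nontrivial u0_supp Rr.
have au1 := average_gt0 _ _ _ u1_L1loc u1_ge0 u1_nontrivial u1_supp Rr.
have [a a0 data] := data_lower_bound c H b m2 beta p mu R0 u0 u1 hc hH hb hm2 hbm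
  hmu u0_L1loc u1_L1loc au0 au1.
have [k k0 fb] := feedback c H b m2 beta p mu R0 u0 u1 hc hH hb hm2 hbm
  hbeta hp hmu hR0 u0_L1loc u1_L1loc au0 au1.
have q1 : 1 < (beta + 1) * p.
  have : 0 <= beta * p by rewrite mulr_ge0//; lra.
  lra.
have [K K0 bound] := lifespan_bound _ _ _ q1 a0 k0.
exists 1, 1, K; split=> // eps /andP[e0 e1] T u [_ usol _].
have TK : (T <= (1 * expR (K * eps `^ (- ((beta + 1) * p - 1))))%:E)%E.
  rewrite mul1r opprB.
  apply: (bound eps T (normalised_average c H b m2 R0 u)); first by rewrite e0.
    exact: data (ltW e0) usol.
  exact: fb (ltW e0) usol.
by split=> //; exact: le_lt_trans TK (ltry _).
Qed.
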